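(* Let $\varphi=(1+\sqrt5)/2$, and let (D) denote the statement $f_\gamma\sim\varphi^{2\gamma}$ (as $\gamma\to\infty$). Then: (1) (D) is equivalent to $f_\gamma\sim n_{2\gamma}$. (2) (D) implies $\lim_{\gamma\to\infty}\frac{f_{\gamma+1}}{f_\gamma}=\varphi^2$. (3) If $\lim_{\gamma\to\infty}\frac{f_{\gamma+1}}{f_\gamma}=\varphi^2$, then $\lim_{\gamma\to\infty}\frac{f_{\gamma+1}}{\sum_{i=0}^{\gamma}f_i}=\varphi$.
   Context: A numerical semigroup $S$ is a submonoid of $(\mathbb{N}_0,+)$ ($\mathbb{N}_0$ the nonnegative integers) with finite complement in $\mathbb{N}_0$; its genus is the number of elements of $\mathbb{N}_0\setminus S$. $\mathcal{S}_g$ is the set of numerical semigroups of genus $g$ and $n_g=\#\mathcal{S}_g$. For a numerical semigroup $S$, a (finite) set $B\subseteq\mathbb{N}_0$ is $S$-closed if for all $b\in B$, $s\in S$ either $b+s\in B$ or $b+s>\max(B)$. $C(S,i)$ is the collection of $S$-closed sets $B$ with $0\in B$ and $\#B=i$, and $f_\gamma:=\sum_{S\in\mathcal{S}_\gamma}\#C(S,\gamma+1)$. For sequences of positive reals, $a_\gamma\sim b_\gamma$ means that $\lim_{\gamma\to\infty}a_\gamma/b_\gamma$ exists and is a positive real number (not necessarily $1$). *)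

(* Defs.v *)
From mathcomp Require Import all_boot all_order all_algebra finmap.
From mathcomp Require Import all_classical all_reals all_analysis.

Set Implicit Arguments.
Unset Strict Implicit.
Unset Printing Implicit Defensive.

Import Order.TTheory GRing.Theory Num.Theory.
Import numFieldNormedType.Exports.

Local Open Scope classical_set_scope.
Local Open Scope nat_scope.

Definition numerical_semigroup (S : set nat) : Prop :=
  [/\ S 0, forall x y, S x -> S y -> S (x + y) & finite_set (~` S)].

(* [fset_set A] is [A] as a finite set if [A] is finite and is empty otherwise;
   here and below it is only used on finite sets, cf. [semigroups_of_finite]
   and [closed_sets_finite]. *)
Definition genus (S : set nat) : nat := #|` fset_set (~` S)|.

Definition semigroups_of (g : nat) : set (set nat) :=
  [set S | numerical_semigroup S /\ genus S = g].

Definition nsg (g : nat) : nat := #|` fset_set (semigroups_of g)|.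

Definition max_fset (B : {fset nat}) : nat := \max_(b <- B) b.

Definition sg_closed (S : set nat) (B : {fset nat}) : Prop :=
  forall b s, b \in B -> S s -> b + s \in B \/ max_fset B < b + s.

Definition closed_sets (S : set nat) (i : nat) : set {fset nat} :=
  [set B : {fset nat} | [/\ sg_closed S B, 0 \in B & #|` B| = i]].

Definition fsg (gamma : nat) : nat :=
  \sum_(S <- fset_set (semigroups_of gamma))
    #|` fset_set (closed_sets S gamma.+1)|.

Lemma mem_fset_iota (m k x : nat) :
  (x \in [fset y in iota m k]%fset) = (m <= x < m + k).
Proof. by rewrite in_fset -mem_iota. Qed.

Lemma finite_bounded_fset (N : nat) :
  finite_set [set B : {fset nat} | forall b, b \in B -> b < N].
Proof.
pose A : {fset nat} := [fset x in iota 0 N]%fset.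
apply: (@sub_finite_set _ _ [set` fpowerset A]); last exact: finite_fset.
move=> B /= hB; rewrite fpowersetE; apply/fsubsetP => b /hB bN.
by rewrite mem_fset_iota.
Qed.

Lemma gap_lt (S : set nat) (f : nat) :
  numerical_semigroup S -> ~ S f -> f < (genus S).*2.
Proof.
move=> [S0 SD fS] nSf; rewrite /genus; set G := fset_set _.
have GP x : (x \in G) <-> ~ S x by rewrite in_fset_set// in_setE.
pose A : {fset nat} := [fset x in iota 0 f.+1]%fset.
have cA : #|` A| = f.+1.
  by rewrite card_fseq undup_id ?iota_uniq// size_iota.
have sA : (A `<=` G `|` [fset y in [seq f - x | x <- G]])%fset.
  apply/fsubsetP => x; rewrite mem_fset_iota /= add0n ltnS => xf; rewrite in_fsetU.
  apply/orP; have [Sx|nSx] := pselect (S x); last by left; apply/GP.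
  right; rewrite in_fset; apply/mapP; exists (f - x); last by rewrite subKn.
  by apply/GP => Sfx; apply: nSf; rewrite -(subnKC xf); exact: SD.
rewrite -cA (leq_trans (fsubset_leq_card sA))// cardfsU.
rewrite (leq_trans (leq_subr _ _))// -addnn leq_add2l.
by rewrite card_fseq (leq_trans (size_undup _))// size_map.
Qed.

Lemma semigroups_of_finite (g : nat) : finite_set (semigroups_of g).
Proof.
have := finite_image (fun B : {fset nat} => ~` [set` B])
  (finite_bounded_fset g.*2).
apply: sub_finite_set => S [nS gS] /=.
have [_ _ fS] := nS.
exists (fset_set (~` S)); last by rewrite fset_setK// setCK.
by move=> b; rewrite in_fset_set// in_setE => nSb; rewrite -gS; exact: gap_lt.
Qed.

Lemma closed_sets_finite (S : set nat) (i : nat) :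
  numerical_semigroup S -> finite_set (closed_sets S i).
Proof.
move=> nS; pose N := (genus S).*2.
apply: sub_finite_set (finite_bounded_fset (N + i)) => B [cB B0 Bi] b bB.
have bM : b <= max_fset B by rewrite /max_fset; exact: leq_bigmax_seq.
apply: (leq_ltn_trans bM); rewrite ltnNge; apply/negP => hM.
pose A : {fset nat} := [fset x in iota N i.+1]%fset.
have cA : #|` A| = i.+1.
  by rewrite card_fseq undup_id ?iota_uniq// size_iota.
have sA : (A `<=` B)%fset.
  apply/fsubsetP => x; rewrite mem_fset_iota addnS ltnS => /andP[Nx xN].
  have Sx : S x by apply: contrapT => /(gap_lt nS); rewrite ltnNge Nx.
  have [//|] := cB 0 x B0 Sx.
  by rewrite add0n ltnNge (leq_trans xN hM).
by have := fsubset_leq_card sA; rewrite cA Bi ltnn.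
Qed.

Local Open Scope ring_scope.

Definition golden {R : realType} : R := (1 + Num.sqrt 5) / 2.

(* The limit of the ratio only has to be some positive real, not 1. *)
Definition asymp {R : realType} (a b : R^nat) : Prop :=
  exists2 l : R, 0 < l & (fun k => a k / b k) @ \oo --> l.

(* Main.v *)
Require Import Defs.
From mathcomp Require Import all_boot all_order all_algebra finmap.
From mathcomp Require Import all_classical all_reals all_analysis.
From mathcomp Require Import ring lra zify.

Set Implicit Arguments.
Unset Strict Implicit.
Unset Printing Implicit Defensive.

Import Order.TTheory GRing.Theory Num.Theory.
Import numFieldNormedType.Exports.

Local Open Scope classical_set_scope.
Local Open Scope ring_scope.

(** Part (1) amounts to Zhai's theorem that [n_g / phi ^+ g] converges to a
    positive limit ([nsg_growth]): granting it, the ratios in the two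
    relations differ by a factor with a positive limit. Part (2) is a quotient
    of consecutive terms of a convergent sequence. For part (3), the
    quotients [u_n] of the n-th partial sum by [f n] satisfy [u_(n+1) = 1 +
    (f n / f (n+1)) * u_n], asymptotically an affine contraction of ratio
    [phi ^- 2] whose fixed point is [phi].

    Zhai's theorem is proved in Kunz coordinates. A semigroup of
    multiplicity [m] is encoded by the list [k_1, ..., k_(m-1)], where [k_i
    * m + i] is its least element congruent to [i] modulo [m]; its genus is
    the sum of the list, and the lists that occur are those with positive
    entries, [k_(i+j) <= k_i + k_j] for [i + j < m] and [k_(i+j-m) <= k_i +
    k_j + 1] for [i + j > m] ([semigroups_of_kunz]).

    For lists with entries at most 3 the second constraint is void, and
    appending 1 or 2 to such a list is always allowed, so their number [d_g]
    satisfies [d_(g+2) = d_(g+1) + d_g + c_(g+2)], where [c_g] counts the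
    lists that end with 3 ([shallow_recurrence]). As [x = phi^-1] satisfies
    [x + x ^+ 2 = 1], the limit of [d_g * x ^+ g] exists and is positive as
    soon as the sum of the [c_g * x ^+ g] is finite. The other lists have an
    entry at least 4, and they are negligible as soon as the sum of [x ^+
    sumn k] over them is finite. These two finiteness statements
    ([stressed_bounded] and [deep_bounded]) are the heart of the proof. They
    are proved with [x] replaced by the slightly larger rational number [13
    / 21].

    Let [q >= 3] be the largest entry (capped at 6) and [l] the last
    position of an entry at least [q]. Then [k_i + k_(l-i) >= q] before [l],
    and [k_i + k_(l+m-i) >= q - 1] after it: each of the two segments folds
    into mirrored pairs. (A list that ends with 3 has only the first
    segment.) For [q = 6] the total weight of one such pair is already below
    1. For [q <= 5] it need not be, but if [a] is the first position of an
    entry 1, then [k_(i+a) <= k_i + 1], so that the pairs, linked by the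
    step [i -> i + a], form chains along which a transfer operator contracts
    ([chains_bound], [potential_contract]). The beginnings of the chains are
    paid for by the entries before [a]: all of them are at least 2. The
    resulting weight is exponentially small in [m], uniformly in [l] and
    [a]. *)

(** * Sums bounded over all finite subsets *)

(** For nonnegative [F] this bounds the unordered sum of [F] over the possibly
    infinite set [A], without leaving the field [R]. *)
Definition sum_bounded {R : realType} {T : eqType} (F : T -> R) (A : set T)
    (c : R) : Prop :=
  forall Y : seq T, uniq Y -> (forall y, y \in Y -> A y) ->
    \sum_(y <- Y) F y <= c.

Lemma sum_boundedW (R : realType) (T : eqType) (F : T -> R) (A B : set T)
    (c d : R) :
  A `<=` B -> c <= d -> sum_bounded F B c -> sum_bounded F A d.
Proof.
move=> AB cd H Y uY YA; apply: le_trans cd; apply: H => // y /YA; exact: AB.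
Qed.

(** Tonelli along the fibres of [p]: sum over each fibre first, then over the
    base. *)
Lemma sum_bounded_fibration (R : realType) (T U : eqType) (F : T -> R)
    (G : U -> R) (A : set T) (B : set U) (p : T -> U) (c d : R) :
  0 <= c -> (forall t, A t -> B (p t)) ->
  (forall u, B u -> sum_bounded F [set t | A t /\ p t = u] (c * G u)) ->
  sum_bounded G B d -> sum_bounded F A (c * d).
Proof.
move=> c0 AB fib GB Y uY YA; pose V := undup (map p Y).
have VB u : u \in V -> B u.
  by rewrite mem_undup => /mapP[t tY ->]; apply/AB/YA.
have -> : \sum_(y <- Y) F y = \sum_(u <- V) \sum_(y <- Y | p y == u) F y.
  rewrite (exchange_big_dep predT)//= [LHS]big_seq [RHS]big_seq.
  apply: eq_bigr => y yY.
  rewrite (eq_bigl (pred1 (p y))); last by move=> u /=; rewrite eq_sym.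
  rewrite -big_filter filter_pred1_uniq ?undup_uniq ?big_seq1//.
  by rewrite mem_undup map_f.
apply: (@le_trans _ _ (\sum_(u <- V) c * G u)).
  rewrite [leLHS]big_seq [leRHS]big_seq; apply: ler_sum => u uV.
  rewrite -big_filter; apply: (fib u (VB u uV)); first exact: filter_uniq.
  by move=> y; rewrite mem_filter => /andP[/eqP py yY]; split=> //; exact: YA.
by rewrite -mulr_sumr; apply: ler_wpM2l => //; apply: GB => //; exact: undup_uniq.
Qed.

Lemma sum_bounded_inj (R : realType) (T U : eqType) (F : T -> R)
    (G : U -> R) (A : set T) (B : set U) (p : T -> U) (c : R) :
  (forall t, A t -> B (p t) /\ F t <= G (p t)) ->
  (forall s t, A s -> A t -> p s = p t -> s = t) ->
  sum_bounded G B c -> sum_bounded F A c.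
Proof.
move=> AB pI GB Y uY YA.
apply: (@le_trans _ _ (\sum_(u <- map p Y) G u)).
  rewrite big_map [leLHS]big_seq [leRHS]big_seq; apply: ler_sum => y yY.
  by have [] := AB y (YA y yY).
apply: GB => [|u /mapP[t tY ->]]; last by have [] := AB t (YA t tY).
by rewrite map_inj_in_uniq// => s t sY tY; apply: pI; exact: YA.
Qed.

Lemma ler_sum_uniq_sub (R : realType) (T : eqType) (F : T -> R) (Y L : seq T) :
  (forall t, t \in L -> 0 <= F t) -> uniq Y -> {subset Y <= L} ->
  \sum_(y <- Y) F y <= \sum_(y <- L) F y.
Proof.
elim: Y L => [|y Y IH] L F0 /=.
  by move=> _ _; rewrite big_nil big_seq; apply: sumr_ge0.
move=> /andP[yY uY] YL; have yL : y \in L by apply: YL; rewrite mem_head.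
rewrite big_cons (perm_big _ (perm_to_rem yL)) /= big_cons lerD2l.
apply: IH => // [t /mem_rem/F0//|z zY].
have zL : z \in L by apply: YL; rewrite in_cons zY orbT.
have zy : z != y by apply: contraNneq yY => <-.
by move: zL; rewrite (perm_mem (perm_to_rem yL)) in_cons (negbTE zy).
Qed.

Lemma sum_bounded_seq (R : realType) (T : eqType) (F : T -> R) (L : seq T)
    (P : pred T) (A : set T) :
  (forall t, 0 <= F t) -> (forall t, A t -> (t \in L) && P t) ->
  sum_bounded F A (\sum_(t <- L | P t) F t).
Proof.
move=> F0 AL Y uY YA; rewrite -[leRHS]big_filter.
apply: ler_sum_uniq_sub => // t /YA/AL; by rewrite mem_filter andbC.
Qed.

(** Union bound; the sets [B i] may overlap. *)
Lemma sum_bounded_cover (R : realType) (T : eqType) (F : T -> R) (A : set T)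
    (n : nat) (B : nat -> set T) (c : nat -> R) :
  (forall t, 0 <= F t) ->
  (forall t, A t -> exists2 i, (i < n)%N & B i t) ->
  (forall i, (i < n)%N -> sum_bounded F (A `&` B i) (c i)) ->
  sum_bounded F A (\sum_(i < n) c i).
Proof.
move=> F0 AB Bc Y uY YA.
apply: (@le_trans _ _ (\sum_(i < n) \sum_(y <- Y | `[< B i y >]) F y)).
  rewrite (exchange_big_dep predT)//= [leLHS]big_seq [leRHS]big_seq.
  apply: ler_sum => y yY; have [i lin Biy] := AB y (YA y yY).
  rewrite (bigD1 (Ordinal lin)) /=; last exact/asboolP.
  by rewrite lerDl; apply: sumr_ge0.
apply: ler_sum => i _; rewrite -big_filter.
apply: Bc => //; first exact: filter_uniq.
by move=> y; rewrite mem_filter => /andP[/asboolP Biy yY]; split => //; exact: YA.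
Qed.

Lemma sum_bounded_exhaust (R : realType) (T : eqType) (F : T -> R) (A : set T)
    (h : T -> nat) (c : R) :
  (forall M, sum_bounded F (A `&` [set t | (h t < M)%N]) c) ->
  sum_bounded F A c.
Proof.
move=> H Y uY YA; apply: (H (\max_(y <- Y) h y).+1) => // y yY.
split; first exact: YA.
by rewrite /= ltnS; apply: leq_bigmax_seq.
Qed.

(** * Chains of states and the transfer operator *)

(** Position [i] is linked to position [i - a], so that the list consists of
    [a] interleaved chains, whose first elements are the [a] first entries. *)
Definition chains {T : Type} (x0 : T) (L : set T) (start : nat -> set T)
    (ok : T -> T -> Prop) (a n : nat) : set (seq T) :=
  [set s | size s = n /\ forall i, (i < n)%N ->
     [/\ L (nth x0 s i), (i < a)%N -> start i (nth x0 s i)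
       & (a <= i)%N -> ok (nth x0 s (i - a)%N) (nth x0 s i)]].

Lemma take_rcons_size (T : Type) (n : nat) (s : seq T) (t : T) :
  size s = n -> take n (rcons s t) = s.
Proof. by move=> sn; rewrite -cats1 take_size_cat. Qed.

Lemma chains_rcons (T : Type) (x0 : T) (L : set T) (start : nat -> set T)
    (ok : T -> T -> Prop) (a n : nat) (s : seq T) (t : T) : (0 < a)%N ->
  chains x0 L start ok a n.+1 (rcons s t) ->
  [/\ chains x0 L start ok a n s, L t, (n < a)%N -> start n t
    & (a <= n)%N -> ok (nth x0 s (n - a)%N) t].
Proof.
move=> a0 [/eqP]; rewrite size_rcons eqSS => /eqP sn H.
have [] := H n (leqnn _); rewrite nth_rcons sn ltnn eqxx => Lt st okt.
split=> // [|an]; last first.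
  by have := okt an; rewrite nth_rcons sn ifT//; lia.
split=> // i iltn; have [] := H i (ltnW iltn).
rewrite !nth_rcons sn iltn => ? ? H3; split=> // ai.
by have := H3 ai; rewrite ifT//; lia.
Qed.

(** The states are summed out from the last to the first.  At any moment the
    last [a] remaining positions are the open ends of the chains, and the
    potential [g i] at such a position [i] bounds the weight of what has been
    removed after it on its chain.  Summing out position [i] consumes [g i]
    and, if [i] is not the start of a chain, creates [g (i - a)]. *)
Lemma chains_bound (R : realType) (T : eqType) (x0 : T) (w : T -> R)
    (L : set T) (start : nat -> set T) (ok : T -> T -> Prop) (a N : nat)
    (g : nat -> T -> R) (c : nat -> R) :
  (0 < a)%N -> (forall t, 0 <= w t) -> (forall i t, 0 <= g i t) ->
  (forall i, 0 <= c i) ->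
  (forall i, (i < N)%N -> (i < a)%N ->
     sum_bounded (fun t => w t * g i t) [set t | L t /\ start i t] (c i)) ->
  (forall i s, (i < N)%N -> (a <= i)%N -> L s ->
     sum_bounded (fun t => w t * g i t) [set t | L t /\ ok s t]
       (c i * g (i - a)%N s)) ->
  (forall i t, (i < N)%N -> (N <= i + a)%N -> L t -> 1 <= g i t) ->
  sum_bounded (fun s => \prod_(t <- s) w t) (chains x0 L start ok a N)
    (\prod_(i < N) c i).
Proof.
move=> a0 w0 g0 c0 gst gok g1.
have pw0 s : 0 <= \prod_(t <- s) w t by apply: prodr_ge0.
have aux n : (n <= N)%N ->
  sum_bounded (fun s => \prod_(t <- s) w t *
                 \prod_(n - a <= i < n) g i (nth x0 s i))
    (chains x0 L start ok a n) (\prod_(i < n) c i).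
  elim: n => [_|n IH nN].
    move=> Y uY Y0; rewrite big_ord0.
    have -> : \sum_(y <- Y) (\prod_(t <- y) w t *
        \prod_(0 - a <= i < 0) g i (nth x0 y i)) = \sum_(y <- Y) (1 : R).
      rewrite big_seq [RHS]big_seq; apply: eq_bigr => y /Y0[/size0nil-> _].
      by rewrite big_nil big_geq// mulr1.
    rewrite big_const_seq count_predT iter_addr_0 -[leRHS]/(1%:R) ler_nat.
    have -> : (1 = size [:: [::]: seq T])%N by [].
    by apply: uniq_leq_size => // y /Y0[/size0nil-> _].
  rewrite big_ord_recr /= mulrC.
  apply: (@sum_bounded_fibration _ _ _ _ _ _ _ (take n) _ _ _ _ _ (IH (ltnW nN))) => //.
    move=> s Cs; case: (lastP s) Cs => [[]//|s' t] Cs.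
    have := Cs.1; rewrite size_rcons => -[s'n].
    by rewrite take_rcons_size//; have [] := chains_rcons a0 Cs.
  move=> u Cu.
  (* The weight of the fixed part [u], without the potential at [n - a]. *)
  pose K : R := \prod_(t <- u) w t * \prod_(n.+1 - a <= i < n) g i (nth x0 u i).
  have K0 : 0 <= K by rewrite mulr_ge0// prodr_ge0.
  have fib d : sum_bounded (fun t => w t * g n t)
      [set t | L t /\ (((n < a)%N -> start n t) /\
               ((a <= n)%N -> ok (nth x0 u (n - a)%N) t))] d ->
    sum_bounded (fun s => \prod_(t <- s) w t *
                 \prod_(n.+1 - a <= i < n.+1) g i (nth x0 s i))
      [set s | chains x0 L start ok a n.+1 s /\ take n s = u] (K * d).
    move=> Hd.
    apply: (@sum_bounded_inj _ _ _ _ (fun t => K * (w t * g n t)) _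
      [set t | L t /\ (((n < a)%N -> start n t) /\
               ((a <= n)%N -> ok (nth x0 u (n - a)%N) t))]
              (last x0)); last first.
    - move=> Y uY YA; rewrite -mulr_sumr; apply: ler_wpM2l => //.
      exact: (Hd Y uY YA).
    - move=> s1 s2; case: (lastP s1) => [[] []//|{}s1 t1].
      case: (lastP s2) => [_ [] []//|{}s2 t2] [C1 t1u] [C2 t2u].
      rewrite !last_rcons => ->; congr rcons.
      have := C1.1; have := C2.1; rewrite !size_rcons => -[n2] [n1].
      by rewrite -t2u in t1u; rewrite !take_rcons_size in t1u.
    - move=> s; case: (lastP s) => [[[]]//|{}s t] [C su].
      have := C.1; rewrite size_rcons => -[sn].
      move: su; rewrite take_rcons_size// => su; subst u.
      have [_ Lt st okt] := chains_rcons a0 C.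
      rewrite last_rcons; split => //.
      rewrite -cats1 big_cat big_seq1 /= big_nat_recr/=; last by lia.
      rewrite nth_cat sn ltnn subnn /= /K.
      rewrite le_eqVlt; apply/orP; left; apply/eqP.
      rewrite [X in _ * _ * (X * _)](_ : _ =
        \prod_(n.+1 - a <= i < n) g i (nth x0 s i)); first by ring.
      rewrite big_nat [RHS]big_nat; apply: eq_bigr => i /andP[_ iltn].
      by rewrite nth_cat sn iltn.
  have [na|an] := ltnP n a.
    have -> : c n * (\prod_(t <- u) w t * \prod_(n - a <= i < n) g i (nth x0 u i)) = K * c n.
      by rewrite /K (_ : (n - a = n.+1 - a)%N); [rewrite mulrC|lia].
    apply: fib; apply: sum_boundedW (gst n nN na) => // t [Lt [H _]].
    by split => //; exact: H.
  have -> : c n * (\prod_(t <- u) w t * \prod_(n - a <= i < n) g i (nth x0 u i))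
      = K * (c n * g (n - a)%N (nth x0 u (n - a))).
    rewrite /K big_ltn; last by lia.
    by rewrite (_ : (n.+1 - a)%N = (n - a).+1); [ring|lia].
  apply: fib.
  have Lu : L (nth x0 u (n - a)%N) by have [] := Cu.2 (n - a)%N; [lia|].
  by apply: sum_boundedW (gok n _ nN an Lu) => // t [Lt [_ H]]; split => //; exact: H.
apply: (@sum_bounded_inj _ _ _ _ _ _ _ id _ _ _ (aux N (leqnn N))) => //.
move=> s [sN Cs]; split => //.
rewrite ler_peMr//.
rewrite big_nat; elim/big_ind: _ => // [x y ? ?|i /andP[ai iN]].
  by rewrite mulr_ege1.
by apply: g1 => //; [lia|have [] := Cs i iN].
Qed.

(** * Folding a list into mirrored pairs *)

Lemma geometric_sum_le (R : realType) (X : R) (M : nat) : 0 <= X < 1 ->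
  \sum_(i < M) X ^+ i <= (1 - X)^-1.
Proof.
move=> /andP[X0 X1]; rewrite -[leRHS]mul1r ler_pdivlMr ?subr_gt0// mulrC.
have -> : (1 - X) * \sum_(i < M) X ^+ i = 1 - X ^+ M.
  by rewrite -[RHS]opprB subrX1 -mulNr opprB.
by rewrite lerBlDr lerDl exprn_ge0.
Qed.

Lemma sum_bounded_geometric (R : realType) (X : R) : 0 <= X < 1 ->
  sum_bounded (fun v : nat => X ^+ v) setT (1 - X)^-1.
Proof.
move=> X01; apply: (@sum_bounded_exhaust _ _ _ _ id) => M.
have X0 : 0 <= X by case/andP: X01.
apply: sum_boundedW (_ : _ `<=` [set t | (t < M)%N]) (geometric_sum_le M X01) _.
  by move=> t [].
rewrite (_ : \sum_(i < M) X ^+ i = \sum_(i <- iota 0 M | predT i) X ^+ i).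
  by apply: sum_bounded_seq => [t|t /= tM]; [exact: exprn_ge0|rewrite mem_iota; lia].
by rewrite -[M in iota 0 M]subn0 -/(index_iota 0 M) big_mkord.
Qed.

(** Outermost pairs come first.  The middle entry of a list of odd size belongs
    to no pair. *)
Definition folds (t : seq nat) : seq (nat * nat) :=
  mkseq (fun i => (nth 0%N t i, nth 0%N t ((size t).-1 - i)%N)) (size t)./2.

Definition pair_weight {R : realType} (X : R) (s : nat * nat) : R :=
  X ^+ (s.1 + s.2).

Lemma sumn_folds (t : seq nat) :
  sumn t = (\sum_(s <- folds t) (s.1 + s.2) +
            odd (size t) * nth 0 t (size t)./2)%N.
Proof.
rewrite sumnE (big_nth 0%N) /folds big_map -[X in iota 0 X]subn0 -/(index_iota 0 _).
set n := size t; set h := n./2.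
have nE : n = (odd n + (h + h))%N by rewrite addnn odd_double_half.
rewrite /= (@big_cat_nat _ _ _ h) //=; last by rewrite leq_half_double; lia.
rewrite big_split /= -addnA; congr addn.
rewrite (@big_cat_nat _ _ _ (n - h)%N) //=; try lia.
rewrite addnC; congr addn.
  rewrite -{1}[(n - h)%N]add0n big_addn big_nat_rev /=.
  rewrite (_ : (n - (n - h) = h)%N); last by lia.
  by rewrite big_nat [RHS]big_nat; apply: eq_bigr => i ih; congr nth; lia.
case: (boolP (odd n)) nE => on nE; last by rewrite big_geq //; lia.
by rewrite (_ : (n - h = h.+1)%N) ?big_nat1 ?mul1n //; lia.
Qed.

(** The middle entry is all that is lost by folding; summing over its possible
    values costs the factor [(1 - X)^-1]. *)
Lemma fold_bounded (R : realType) (X : R) (n : nat) (C : set (seq (nat * nat)))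
    (d : R) : 0 <= X < 1 ->
  sum_bounded (fun s => \prod_(p <- s) pair_weight X p) C d ->
  sum_bounded (fun t => X ^+ sumn t) [set t | size t = n /\ C (folds t)]
    ((1 - X)^-1 * d).
Proof.
move=> X01; have /andP[X0 X1] := X01.
have W0 s : 0 <= \prod_(p <- s) pair_weight X p.
  by apply: prodr_ge0 => p _; exact: exprn_ge0.
apply: (@sum_bounded_fibration _ _ _ _ _ _ _ folds).
- by rewrite invr_ge0 subr_ge0 ltW.
- by move=> t [].
move=> u Cu.
pose mid (t : seq nat) := (odd (size t) * nth 0 t (size t)./2)%N.
apply: (@sum_bounded_inj _ _ _ _
   (fun v => \prod_(p <- u) pair_weight X p * X ^+ v) _ setT mid).
- move=> t [[tn _] <-]; split => //.
  rewrite {1}sumn_folds exprD le_eqVlt; apply/orP; left; apply/eqP.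
  congr (_ * _).
  elim: (folds t) => [|p s IH]; first by rewrite !big_nil.
  by rewrite !big_cons exprD IH.
- move=> s t [[sn _] su] [[tn _] tu] mst.
  have fst : folds s = folds t by rewrite su tu.
  have E i : (i < n./2)%N -> nth 0%N s i = nth 0%N t i /\
      nth 0%N s (n.-1 - i) = nth 0%N t (n.-1 - i).
    move=> ih; have := congr1 (fun r => nth (0, 0)%N r i) fst.
    by rewrite /folds !nth_mkseq ?sn ?tn// => -[-> ->].
  apply: (@eq_from_nth _ 0%N); first by rewrite sn tn.
  move=> i; rewrite sn => iltn.
  have [ih|hi] := ltnP i n./2; first by have [] := E i ih.
  have := odd_double_half n; rewrite -addnn => nE.
  have [hi'|hi'] := ltnP (n.-1 - i) n./2.
    have [_] := E _ hi'.
    by rewrite (_ : n.-1 - (n.-1 - i) = i)%N//; lia.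
  move: mst; rewrite /mid sn tn.
  case: (odd n) nE => nE; last by lia.
  by rewrite !mul1n (_ : i = n./2)//; lia.
by move=> Y uY _; rewrite -mulr_sumr mulrC ler_wpM2r//; exact: sum_bounded_geometric.
Qed.

(** * Weights of the admissible pairs *)

(** The possible mirrored pairs of a segment.  The two roles of [D], as a bound
    from above for the entries and as a bound from below for the mirrored sums,
    coincide in both segments of a Kunz list of largest entry [q]: there [D] is
    [q] before the last entry [q] and [q.-1] after it. *)
Definition cells (D : nat) : seq (nat * nat) :=
  [seq s <- [seq (p, q) | p <- iota 1 D, q <- iota 1 D] | D <= s.1 + s.2]%N.

(** When the left entry of a pair moves to the right by one step, its mirror
    image moves to the left, hence the opposite directions. *)
Definition step_ok (s u : nat * nat) : bool :=
  ((u.1 <= s.1.+1) && (s.2 <= u.2.+1))%N.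

(** A quotient of Fibonacci numbers slightly above the inverse of the golden
    ratio.  The weights leave enough room for this rounding, which makes all
    the numerical conditions below statements about rational numbers. *)
Definition X0 {R : realType} : R := 13 / 21.
(** The rate of contraction.  It is chosen so close to 1 that the weights of
    the starts of the chains are well approximated by integral powers of it. *)
Definition rho {R : realType} : R := 199 / 200.

(** The row sums of the transfer operator of the chains, that is, the weight of
    the last state of a chain given the state before it, rounded up.  For
    [D = 5] the weight of all the cells together is a sufficient bound. *)
Definition potential_percent (D : nat) (s : nat * nat) : nat :=
  match D, s with
  | 3, (1, 2) => 86
  | 3, (1, _) => 63
  | 3, (_, 3) => 77
  | 3, _ => 116
  | 4, (1, 3) => 54
  | 4, (1, _) => 39
  | 4, (2, 2) => 87
  | 4, (2, 3) => 72
  | 4, (2, _) => 48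
  | 4, (_, 4) => 54
  | 4, (_, 3) => 83
  | 4, _ => 107
  | _, _ => 89
  end%N.

Definition potential {R : realType} (D : nat) (s : nat * nat) : R :=
  (potential_percent D s)%:R / 100.

Lemma X0_itv (R : realType) : 0 <= (X0 : R) < 1.
Proof. by rewrite /X0; apply/andP; split; lra. Qed.

Lemma rho_itv (R : realType) : 0 < (rho : R) < 1.
Proof. by rewrite /rho; apply/andP; split; lra. Qed.

Lemma pair_weight_ge0 (R : realType) (s : nat * nat) :
  0 <= pair_weight (X0 : R) s.
Proof. by apply: exprn_ge0; have /andP[] := X0_itv R. Qed.

Lemma potential_ge0 (R : realType) (D : nat) (s : nat * nat) :
  0 <= (potential D s : R).
Proof. by rewrite /potential divr_ge0. Qed.

Lemma cells5_le (R : realType) :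
  \sum_(u <- cells 5) pair_weight (X0 : R) u <= 89 / 100.
Proof. by rewrite unlock /pair_weight /X0 /=; lra. Qed.

Lemma step_sum_le (R : realType) (D : nat) (s : nat * nat) :
  [\/ D = 3, D = 4 | D = 5]%N -> s \in cells D ->
  \sum_(u <- cells D | step_ok s u) pair_weight (X0 : R) u <= potential D s.
Proof.
move=> [] ->; [move: s; apply/allP..|move=> _].
- rewrite unlock /pair_weight /X0 /potential /=.
  by repeat (apply/andP; split => //); lra.
- rewrite unlock /pair_weight /X0 /potential /=.
  by repeat (apply/andP; split => //); lra.
apply: le_trans (cells5_le R); rewrite big_mkcond /=; apply: ler_sum => u _.
by case: ifP => // _; exact: pair_weight_ge0.
Qed.

(** For [D = 3] and [D = 4] a constant potential would not do, because the
    cells weigh more than 1 in total.  They weigh less for [D = 5], which gives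
    that case at once. *)
Lemma potential_contract (R : realType) (D : nat) (s : nat * nat) :
  [\/ D = 3, D = 4 | D = 5]%N -> s \in cells D ->
  \sum_(u <- cells D | step_ok s u) pair_weight (X0 : R) u * potential D u
    <= rho * potential D s.
Proof.
move=> [] -> sD; last first.
  rewrite /potential /= -mulr_suml; apply: ler_wpM2r; first exact: divr_ge0.
  have D5 : [\/ 5 = 3, 5 = 4 | 5 = 5]%N by apply: Or33.
  by apply: (le_trans (step_sum_le R D5 sD)); rewrite /potential /rho /=; lra.
- move: s sD; apply/allP; rewrite unlock /pair_weight /X0 /potential /rho /=.
  by repeat (apply/andP; split => //); lra.
- move: s sD; apply/allP; rewrite unlock /pair_weight /X0 /potential /rho /=.
  by repeat (apply/andP; split => //); lra.
Qed.

(** In this lemma and the next two, the first bound is for a chain reduced to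
    its start and the second for a longer chain, whose start carries the
    potential. *)
Lemma one_start (R : realType) (D : nat) :
  [\/ D = 3, D = 4 | D = 5]%N ->
  \sum_(u <- cells D | (1 < u.1)%N) pair_weight (X0 : R) u <= 839 / 1000 /\
  \sum_(u <- cells D | (1 < u.1)%N) pair_weight (X0 : R) u * potential D u
    <= 839 / 1000.
Proof.
move=> HD; rewrite /potential unlock /pair_weight /X0.
by case: HD => -> /=; split; lra.
Qed.

Lemma two_start (R : realType) (D : nat) :
  [\/ D = 3, D = 4 | D = 5]%N ->
  \sum_(u <- cells D | ((1 < u.1) && (1 < u.2))%N) pair_weight (X0 : R) u
    <= 70 / 100 /\
  \sum_(u <- cells D | ((1 < u.1) && (1 < u.2))%N)
     pair_weight (X0 : R) u * potential D u <= 70 / 100.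
Proof.
move=> HD; rewrite /potential unlock /pair_weight /X0.
by case: HD => -> /=; split; lra.
Qed.

Lemma free_start (R : realType) (D : nat) :
  [\/ D = 3, D = 4 | D = 5]%N ->
  \sum_(u <- cells D) pair_weight (X0 : R) u <= 116 / 100 /\
  \sum_(u <- cells D) pair_weight (X0 : R) u * potential D u <= 116 / 100.
Proof.
move=> HD; rewrite /potential unlock /pair_weight /X0.
by case: HD => -> /=; split; lra.
Qed.

(** These exponents decide the proof: a chain start without an entry known to be
    at least 2 costs less (30) than one such entry gains (35). *)
Lemma rho_powers (R : realType) :
  [/\ 839 / 1000 <= (rho : R) ^+ 35, 70 / 100 <= (rho : R) ^+ 70
    & 116 / 100 <= (rho : R)^-1 ^+ 30].
Proof.
by rewrite /rho; split; [lra|lra|rewrite invf_div; lra].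
Qed.

(** * Weight of a segment *)

(** [a] is the step of the chains and [b] the number of initial positions known
    to hold entries at least 2.  An entry in the middle is its own mirror
    image. *)
Definition segment (D a b n : nat) : set (seq nat) :=
  [set t | [/\ size t = n,
     forall i, (i < n)%N -> (1 <= nth 0 t i <= D)%N,
     forall i, (i < n)%N -> (D <= nth 0 t i + nth 0 t (n.-1 - i))%N,
     forall i, (i < n)%N -> (i < b)%N -> (2 <= nth 0 t i)%N
   & forall i, (i + a < n)%N -> (nth 0 t (i + a) <= (nth 0 t i).+1)%N]].

Lemma mem_cells (D : nat) (s : nat * nat) :
  (s \in cells D) =
  [&& 1 <= s.1 <= D, 1 <= s.2 <= D & D <= s.1 + s.2]%N.
Proof.
rewrite mem_filter andbC andbA; congr andb; case: s => p q /=.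
apply/allpairsP/andP => [[[p' q'] /= [+ + [-> ->]]]|[p1 q1]].
  by rewrite !mem_iota; lia.
by exists (p, q); rewrite /= !mem_iota; split => //; lia.
Qed.

Lemma count_lt (h b : nat) : (\sum_(i < h) (i < b) = minn h b)%N.
Proof.
elim: h => [|h IH]; first by rewrite big_ord0 min0n.
by rewrite big_ord_recr /= IH; lia.
Qed.

Lemma count_ge (h b : nat) : (\sum_(i < h) (b <= i) = h - b)%N.
Proof.
elim: h => [|h IH]; first by rewrite big_ord0.
by rewrite big_ord_recr /= IH; lia.
Qed.

(** [n - b <= i] says that the mirror image [n.-1 - i] of [i] is less than
    [b]. *)
Definition cell_start (b n i : nat) : set (nat * nat) :=
  [set s | ((i < b)%N -> (1 < s.1)%N) /\ ((n - b <= i)%N -> (1 < s.2)%N)].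

Lemma segment_folds (D a b n : nat) (t : seq nat) : segment D a b n t ->
  chains (0, 0)%N [set s | s \in cells D] (cell_start b n) step_ok a n./2
    (folds t).
Proof.
move=> [tn tD tm tb ta]; split; first by rewrite size_mkseq tn.
move=> i ih; have hn : (n./2 + n./2 <= n)%N by clear; lia.
have iE j : (j < n./2)%N -> nth (0, 0)%N (folds t) j =
    (nth 0%N t j, nth 0%N t (n.-1 - j)).
  by move=> jh; rewrite nth_mkseq tn.
have ltn : (i < n)%N by clear -ih hn; lia.
have ltn' : (n.-1 - i < n)%N by clear -ih hn; lia.
rewrite !iE//; last by clear -ih; lia.
split.
- by rewrite /= mem_cells /= !tD ?tm.
- by move=> ia; split=> /= [ib|bi]; apply: tb => //; clear -ih hn bi; lia.
- move=> ai; rewrite /step_ok/=; apply/andP; split.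
    by rewrite -{1}(subnK ai); apply: ta; rewrite subnK.
  rewrite (_ : n.-1 - (i - a) = n.-1 - i + a)%N; last by clear -ih ai hn; lia.
  by apply: ta; clear -ih ai hn; lia.
Qed.

(** Each of the [minn b n] positions below [b] gains 35, except possibly the
    middle one, which belongs to no pair.  A pair that is neither the start
    nor the end of a chain gains 1; all but at most [2 * a] pairs
    are of this kind. *)
Lemma start_exponent (a b n : nat) : (b <= a)%N ->
  (35 * (minn b n).-1 + (n./2 - 2 * a) <= \sum_(i < n./2)
    if (i < a) then 35 * ((i < b) + (n - b <= i)) else (i + a < n./2))%N.
Proof.
move=> ba; set h := n./2.
have -> : (\sum_(i < h) (if (i < a) then 35 * ((i < b) + (n - b <= i))
                          else (i + a < h)) =
    35 * \sum_(i < h) ((i < b) + ((i < a) && (n - b <= i)))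
    + \sum_(i < h) ((a <= i) && (i + a < h)))%N.
  rewrite big_distrr -big_split /=; apply: eq_bigr => i _.
  by have [ia|ai] := ltnP i a; lia.
rewrite big_split /= count_lt.
apply: leq_add; [rewrite leq_mul2l/=|].
  have -> : (\sum_(i < h) ((i < a) && (n - b <= i)) =
             \sum_(i < h) (n - b <= i))%N.
    by apply: eq_bigr => i _; have := ltn_ord i; rewrite /h; lia.
  by rewrite count_ge; rewrite /h; lia.
have -> : (\sum_(i < h) ((a <= i) && (i + a < h)) = \sum_(i < h) (i < h - a) -
      \sum_(i < h) (i < minn a (h - a)))%N.
  apply/eqP; rewrite eq_sym -(eqn_add2r (\sum_(i < h) (i < minn a (h - a)))) subnK.
    by rewrite -big_split /=; apply/eqP; apply: eq_bigr => i _; lia.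
  by apply: leq_sum => i _; lia.
by rewrite !count_lt; lia.
Qed.

(** Among the starts of the [a] chains, those below [b] are not charged. *)
Lemma free_exponent (a b h : nat) : (b <= a)%N ->
  (\sum_(i < h) 30 * ((i < a) && (b <= i)) <= 30 * (a - b))%N.
Proof.
move=> ba; rewrite -big_distrr leq_mul2l /=.
have -> : (\sum_(i < h) ((i < a) && (b <= i)) =
           \sum_(i < h) (i < a) - \sum_(i < h) (i < b))%N.
  apply/eqP; rewrite eq_sym -(eqn_add2r (\sum_(i < h) (i < b))) subnK.
    by rewrite -big_split /=; apply/eqP; apply: eq_bigr => i _; lia.
  by apply: leq_sum => i _; lia.
by rewrite !count_lt; lia.
Qed.

(** The exponents collect the gains and losses of all pairs: see
    [start_exponent] and [free_exponent]. *)
Lemma segment_bounded (R : realType) (D a b n : nat) :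
  [\/ D = 3, D = 4 | D = 5]%N -> (0 < a)%N -> (b <= a)%N ->
  sum_bounded (fun t => (X0 : R) ^+ sumn t) (segment D a b n)
    ((1 - X0)^-1 * (rho ^+ (35 * (minn b n).-1 + (n./2 - 2 * a)) *
                    rho^-1 ^+ (30 * (a - b)))).
Proof.
move=> HD a0 ba; set h := n./2.
have /andP[r0 r1] := rho_itv R; have /andP[X00 X01] := X0_itv R.
have [rho1 rho2 rho0] := rho_powers R.
(* Gain of the i-th pair: at the start of a chain, 35 for each entry at least 2;
   later, 1 unless the chain ends there. *)
pose e i := (if (i < a)%N then 35 * ((i < b) + (n - b <= i)) else (i + a < h))%N.
pose c i : R := rho ^+ e i * rho^-1 ^+ (30 * ((i < a) && (b <= i)))%N.
pose L := [set s | s \in cells D].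
pose st i := cell_start b n i.
pose g i (u : nat * nat) : R := if (i + a < h)%N then potential D u else 1.
have w0 u : 0 <= pair_weight (X0 : R) u by exact: pair_weight_ge0.
have g0 i u : 0 <= g i u by rewrite /g; case: ifP => // _; exact: potential_ge0.
have c0 i : 0 <= c i by rewrite mulr_ge0// exprn_ge0// ?invr_ge0 ltW.
pose C := chains (0, 0)%N L st step_ok a h.
have chainP : sum_bounded (fun s => \prod_(p <- s) pair_weight (X0 : R) p)
    C (\prod_(i < h) c i).
  apply: (chains_bound (g := g)) => //.
  - move=> i ih ia.
    have H (P : pred (nat * nat)) (d : R) : (forall u, st i u -> P u) ->
        \sum_(u <- cells D | P u) pair_weight (X0 : R) u <= d /\
        \sum_(u <- cells D | P u) pair_weight (X0 : R) u * potential D u <= d ->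
        d <= c i ->
        sum_bounded (fun t => pair_weight X0 t * g i t)
          [set t | L t /\ st i t] (c i).
      move=> stP [d1 d2] dc.
      apply: (@sum_boundedW _ _ _ _ [set t | L t /\ st i t]
        (\sum_(u <- cells D | P u) pair_weight X0 u * g i u)) => //.
        apply: (le_trans _ dc); rewrite /g; case: (i + a < h)%N => //.
        by under eq_bigr => u _ do rewrite mulr1.
      apply: sum_bounded_seq => [u|u [Lu /stP Pu]]; first exact: mulr_ge0.
      by rewrite Pu andbT.
    have [ib|bi] := ltnP i b; last first.
      apply: (H predT _ _ (free_start R HD)) => //.
      rewrite /c /e ia bi (ltnNge i b) bi/= (_ : (n - b <= i)%N = false); last by lia.
      by rewrite muln0 expr0 mul1r muln1.
    have [ib'|bi'] := leqP (n - b)%N i.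
      apply: (H (fun u => (1 < u.1) && (1 < u.2))%N _ _ (two_start R HD)).
        by move=> u [u1 u2]; rewrite u1// u2.
      by rewrite /c /e ia ib ib' (leqNgt b) ib/= muln0 expr0 mulr1.
    apply: (H (fun u => (1 < u.1))%N _ _ (one_start R HD)).
      by move=> u [u1 _]; rewrite u1.
    by rewrite /c /e ia ib (leqNgt (n - b)) bi' (leqNgt b) ib/= muln0 expr0 mulr1.
  - move=> i s ih ai Ls.
    have -> : g (i - a)%N s = potential D s by rewrite /g subnK// ih.
    apply: (@sum_boundedW _ _ _ _ [set t | L t /\ step_ok s t]
        (\sum_(u <- cells D | step_ok s u) pair_weight X0 u * g i u)) => //.
      rewrite /g /c /e (ltnNge i a) ai/= muln0 expr0 mulr1.
      case: (i + a < h)%N; first by rewrite expr1; exact: potential_contract.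
      under eq_bigr => u _ do rewrite mulr1.
      by rewrite expr0 mul1r; exact: step_sum_le.
    apply: sum_bounded_seq => [u|u [Lu su]]; first exact: mulr_ge0.
    by apply/andP; split.
  - by move=> i u ih hi _; rewrite /g ltnNge hi.
have FB := fold_bounded (n := n) (X0_itv R) chainP.
apply: (sum_boundedW (A := segment D a b n) _ _ FB).
  by move=> t St; split; [case: St|exact: segment_folds].
apply: ler_wpM2l; first by rewrite invr_ge0 subr_ge0 ltW.
rewrite big_split /= !prodrXr; apply: ler_pM.
- by apply: exprn_ge0; exact: ltW.
- by apply: exprn_ge0; rewrite invr_ge0 ltW.
- by apply: ler_wiXn2l; [exact: ltW|exact: ltW|exact: start_exponent].
- by apply: ler_weXn2l; [rewrite invf_ge1// ltW|exact: free_exponent].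
Qed.

(** * Kunz lists and their total weight *)

(** The entry of index [i] belongs to the residue [i + 1], hence the shift. *)
Definition subadditive_seq (k : seq nat) : Prop :=
  forall i j, (i + j + 1 < size k)%N ->
    (nth 0 k (i + j + 1) <= nth 0 k i + nth 0 k j)%N.

Definition wrap_subadditive_seq (k : seq nat) : Prop :=
  forall i j, (i < size k)%N -> (j < size k)%N -> (size k <= i + j)%N ->
    (nth 0 k (i + j - size k) <= (nth 0 k i + nth 0 k j).+1)%N.

Definition kunz (k : seq nat) : Prop :=
  [/\ forall i, (i < size k)%N -> (0 < nth 0 k i)%N, subadditive_seq k
    & wrap_subadditive_seq k].

(** The lists with entries at most 3 that do not arise from a shorter one by
    appending 1 or 2. *)
Definition stressed (k : seq nat) : Prop :=
  [/\ (0 < size k)%N, forall i, (i < size k)%N -> (0 < nth 0 k i <= 3)%N,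
      subadditive_seq k & nth 0%N k (size k).-1 = 3%N].

Lemma sum_bounded_prod (R : realType) (T U : eqType) (F : T -> R) (G : U -> R)
    (A : set T) (B : set U) (c d : R) :
  (forall t, 0 <= F t) -> 0 <= d ->
  sum_bounded F A c -> sum_bounded G B d ->
  sum_bounded (fun s => F s.1 * G s.2) [set s | A s.1 /\ B s.2] (d * c).
Proof.
move=> F0 d0 FA GB.
apply: (sum_bounded_fibration (p := fst) d0 _ _ FA) => [s []//|t At].
apply: (@sum_bounded_inj _ _ _ _ (fun u => F t * G u) _ B snd).
- by move=> [t' u] /= [[_ Bu] ->].
- by move=> [t1 u1] [t2 u2] /= [_ ->] [_ ->] ->.
- by move=> Y uY YB; rewrite -mulr_sumr mulrC ler_wpM2r//; exact: GB.
Qed.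

(** When a single pair weighs at most [rho], no link between the pairs is
    needed. *)
Lemma naive_segment_bounded (R : realType) (L : set (nat * nat)) (n : nat) :
  sum_bounded (pair_weight (X0 : R)) L rho ->
  sum_bounded (fun t => (X0 : R) ^+ sumn t)
    [set t | size t = n /\ forall i, (i < n)%N ->
                          L (nth 0%N t i, nth 0%N t (n.-1 - i)%N)]
    ((1 - X0)^-1 * rho ^+ n./2).
Proof.
move=> HL; have /andP[r0 _] := rho_itv R.
have chainP : sum_bounded (fun s => \prod_(p <- s) pair_weight (X0 : R) p)
    (chains (0, 0)%N L (fun _ => setT) (fun _ _ => True) n./2.+1 n./2)
    (\prod_(i < n./2) (rho : R)).
  apply: (chains_bound (g := fun _ _ => 1) (c := fun _ => rho)) => //.
  - exact: pair_weight_ge0.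
  - by move=> _; exact: ltW.
  - move=> i _ _; under eq_fun do rewrite mulr1.
    by apply: sum_boundedW HL => // t [].
  - by move=> i s ih ai; have := leq_ltn_trans ai ih; rewrite ltnNge leqnSn.
rewrite prodr_const card_ord in chainP.
have FB := fold_bounded (n := n) (X0_itv R) chainP.
apply: (sum_boundedW _ (lexx _) FB) => t [tn tL]; split => //.
split=> [|i ih]; first by rewrite size_mkseq tn.
split=> //; rewrite nth_mkseq ?tn//; apply: tL.
by clear -ih; lia.
Qed.

Lemma cells5_bounded (R : realType) :
  sum_bounded (pair_weight (X0 : R)) [set s | s \in cells 5] rho.
Proof.
apply: (@sum_boundedW _ _ _ _ _
    (\sum_(u <- cells 5 | predT u) pair_weight X0 u) _ (@subset_refl _ _)).
  by apply: (le_trans (cells5_le R)); rewrite /rho; lra.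
by apply: sum_bounded_seq => [u|u /= ->//]; exact: pair_weight_ge0.
Qed.

(** If the first entry is [i <= 5], the second is at least [6 - i] and the sum
    over it is [X0 ^+ 6 / (1 - X0)]; if the first is at least 6, the second is
    arbitrary.  The total is just below 1. *)
Lemma large_pairs_bounded (R : realType) :
  sum_bounded (pair_weight (X0 : R))
    [set s | [/\ (0 < s.1)%N, (0 < s.2)%N & (6 <= s.1 + s.2)%N]] rho.
Proof.
have X01 := X0_itv R; have /andP[X00 X1] := X01.
(* The first entry is [i + 1] for [i < 5], and at least 6 for [i = 5]. *)
pose B i := [set s : nat * nat | if (i < 5)%N then s.1 = i.+1 else (5 < s.1)%N].
pose c i : R := X0 ^+ 6 * (if (i < 5)%N then (1 - X0)^-1
                           else X0 * ((1 - X0)^-1 * (1 - X0)^-1)).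
apply: (@sum_boundedW _ _ _ _ _ (\sum_(i < 6) c i) _ (@subset_refl _ _)).
  have E : (1 - X0)^-1 = 21 / 8 :> R by rewrite /X0; field.
  rewrite !big_ord_recl big_ord0 /c /= E /X0 /rho.
  lra.
apply: (sum_bounded_cover (B := B)).
- exact: pair_weight_ge0.
- move=> [p q] [/= p0 q0 pq]; have [p5|p5] := leqP p 5; last by exists 5%N.
  case: p p0 p5 {pq} => // p _ p5; exists p; first exact: ltnW.
  by rewrite /B /= p5.
move=> i i6; rewrite /c /B; case: ltnP => i5.
- apply: (@sum_bounded_inj _ _ _ _ (fun v => X0 ^+ 6 * X0 ^+ v) _ setT
     (fun s => s.2 - (5 - i))%N).
  + move=> [p q] [[/= p0 q0 pq] /= pi]; split => //.
    rewrite /pair_weight -exprD /= le_eqVlt; apply/orP; left; apply/eqP.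
    by congr (_ ^+ _); clear -pq pi i5; lia.
  + move=> [p q] [p' q'] [[/= p0 q0 pq] /= pi] [[/= p0' q0' pq'] /= pi'] E.
    by congr pair; clear -pq pq' pi pi' i5 E; lia.
  + move=> Y uY _; rewrite -mulr_sumr ler_wpM2l ?exprn_ge0//.
    exact: sum_bounded_geometric.
- apply: (@sum_bounded_inj _ _ _ _
     (fun s : nat * nat => X0 ^+ 7 * (X0 ^+ s.1 * X0 ^+ s.2)) _
     [set s | setT s.1 /\ setT s.2] (fun s => (s.1 - 6, s.2 - 1)%N)).
  + move=> [p q] [[/= p0 q0 pq] /= pi]; split => //.
    rewrite /pair_weight -!exprD /= le_eqVlt; apply/orP; left; apply/eqP.
    by congr (_ ^+ _); clear -q0 pi; lia.
  + move=> [p q] [p' q'] [[/= p0 q0 pq] /= pi] [[/= p0' q0' pq'] /= pi'] [E E'].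
    by congr pair; clear -q0 q0' pi pi' E E'; lia.
  + move=> Y uY YA; rewrite -mulr_sumr mulrA -exprSr; apply: ler_wpM2l.
      exact: exprn_ge0.
    have G := sum_bounded_geometric X01.
    apply: (sum_bounded_prod _ _ G G) => // [v|]; first exact: exprn_ge0.
    by rewrite invr_ge0 subr_ge0 ltW.
Qed.

Lemma split_bounded (R : realType) (A B : set (seq nat)) (n l : nat) (c d : R) :
  (l < n)%N -> 0 <= c -> 0 <= d ->
  sum_bounded (fun t => (X0 : R) ^+ sumn t) A c ->
  sum_bounded (fun t => (X0 : R) ^+ sumn t) B d ->
  sum_bounded (fun k => (X0 : R) ^+ sumn k)
    [set k | [/\ size k = n, A (take l k) & B (drop l.+1 k)]]
    (d * c * (1 - X0)^-1).
Proof.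
move=> ln c0 d0 HA HB; have X01 := X0_itv R; have /andP[X00 X1] := X01.
have w0 (t : seq nat) : 0 <= (X0 : R) ^+ sumn t by exact: exprn_ge0.
have HAB := sum_bounded_prod w0 d0 HA HB.
have G := sum_bounded_geometric X01.
have HABC := sum_bounded_prod (fun v => exprn_ge0 v X00) (mulr_ge0 d0 c0) G HAB.
apply: (@sum_bounded_inj _ _ _ _ _ _ _
   (fun k => (nth 0%N k l, (take l k, drop l.+1 k))) _ _ _ HABC).
- move=> k [kn Ak Bk]; split; first by [].
  rewrite /=.
  rewrite -!exprD le_eqVlt; apply/orP; left; apply/eqP; congr (_ ^+ _).
  rewrite -[in LHS](cat_take_drop l k) sumn_cat [drop l k](drop_nth 0%N) ?kn//=.
  by rewrite addnCA.
- move=> s t [sn _ _] [tn _ _] [E1 E2 E3].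
  rewrite -(cat_take_drop l s) -(cat_take_drop l t).
  rewrite [drop l s](drop_nth 0%N) ?sn// [drop l t](drop_nth 0%N) ?tn//.
  by rewrite E1 E2 E3.
Qed.

Lemma bernoulli (R : realType) (e : R) (n : nat) : 0 <= e ->
  1 + n%:R * e <= (1 + e) ^+ n.
Proof.
move=> e0; elim: n => [|n IH]; first by rewrite mul0r addr0 expr0.
rewrite exprS; apply: le_trans (_ : _ <= (1 + e) * (1 + n%:R * e)) _; last first.
  by rewrite ler_pM2l ?ltr_wpDr.
have : 0 <= n%:R * e ^+ 2 by rewrite mulr_ge0 ?exprn_ge0.
by rewrite -[n.+1%:R]natr1; lra.
Qed.

(** Both factors of [n.+1 ^ 2] are absorbed by a slight increase of the ratio
    of the geometric series. *)
Lemma quadratic_geometric (R : realType) :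
  exists B : R, forall M, \sum_(n < M) (n.+1 ^ 2)%:R * (rho : R) ^+ n./2 <= B.
Proof.
(* Chosen such that [rho <= s ^+ 2] and [u ^+ 2 * s < 1]. *)
pose s : R := 399 / 400; pose u : R := 1 + 1 / 1000.
exists (2 * 1000 ^+ 2 * (1 - u ^+ 2 * s)^-1) => M.
have t01 : 0 <= u ^+ 2 * s < 1 by rewrite /u /s; apply/andP; split; lra.
apply: le_trans (_ : _ <= \sum_(n < M) (2 * 1000 ^+ 2) * (u ^+ 2 * s) ^+ n) _; last first.
  by rewrite -mulr_sumr; apply: ler_wpM2l (geometric_sum_le M t01); lra.
apply: ler_sum => n _.
have rs : (rho : R) ^+ n./2 <= 2 * s ^+ n.
  apply: le_trans (_ : _ <= (s ^+ 2) ^+ n./2) _.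
    by apply: lerXn2r; rewrite ?nnegrE /rho /s; lra.
  rewrite -exprM -{2}(odd_double_half n) exprD -muln2 mulnC mulrA.
  have s0 : 0 <= s ^+ (n./2 * 2) by apply: exprn_ge0; rewrite /s; lra.
  by rewrite ler_peMl//; case: odd; rewrite /s; lra.
have nu : (n.+1%:R : R) <= 1000 * u ^+ n.
  have /(bernoulli n) H : (0 : R) <= 1 / 1000 by lra.
  by move: H; rewrite -/u -[n.+1%:R]natr1; lra.
have un0 : 0 <= u ^+ n by apply: exprn_ge0; rewrite /u; lra.
rewrite natrX; apply: le_trans (_ : _ <= (1000 * u ^+ n) ^+ 2 * (2 * s ^+ n)) _.
  apply: ler_pM => //; first by apply: exprn_ge0; rewrite /rho; lra.
  apply: lerXn2r nu; rewrite nnegrE; first exact: ler0n.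
  by move: un0; lra.
rewrite [(1000 * _) ^+ 2]exprMn [(u ^+ 2 * s) ^+ n]exprMn -!exprM (mulnC n).
by move: (u ^+ _) (s ^+ n) => y z; rewrite le_eqVlt; apply/orP; left; apply/eqP; ring.
Qed.

(** The factor [n.+1 ^ 2] pays for the choice of two positions in a list of
    size [n]: the last large entry and the first entry 1. *)
Lemma size_graded_bounded (R : realType) (A : set (seq nat)) (c : R) : 0 <= c ->
  (forall n, sum_bounded (fun k => (X0 : R) ^+ sumn k)
     (A `&` [set k | size k = n]) (c * ((n.+1 ^ 2)%:R * rho ^+ n./2))) ->
  exists B, sum_bounded (fun k => (X0 : R) ^+ sumn k) A B.
Proof.
move=> c0 H; have [B HB] := quadratic_geometric R; exists (c * B).
have X01 := X0_itv R; have /andP[X00 X1] := X01.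
apply: (sum_bounded_exhaust (h := size)) => M.
apply: (@sum_boundedW _ _ _ _ _
    (\sum_(n < M) c * ((n.+1 ^ 2)%:R * rho ^+ n./2)) _ (@subset_refl _ _)).
  by rewrite -mulr_sumr ler_wpM2l.
apply: (sum_bounded_cover (B := fun n => [set k | size k = n])
  (c := fun n => c * ((n.+1 ^ 2)%:R * rho ^+ n./2))).
- by move=> k; exact: exprn_ge0.
- by move=> k [_ kM]; exists (size k).
move=> n _; apply: sum_boundedW (H n) => //.
by move=> k [[Ak _] kn].
Qed.

Lemma rho_exchange (R : realType) (E M K h : nat) : (h + M <= E + K)%N ->
  rho ^+ E * rho^-1 ^+ M <= rho^-1 ^+ K * rho ^+ h :> R.
Proof.
move=> hMEK; have /andP[r0 r1] := rho_itv R.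
have ru : (rho : R) != 0 by rewrite gt_eqF.
have -> : rho ^+ E * rho^-1 ^+ M = rho^-1 ^+ (M + K) * rho ^+ (E + K) :> R.
  by rewrite !exprVn !exprD invfM; field; rewrite !expf_neq0.
have -> : rho^-1 ^+ K * rho ^+ h = rho^-1 ^+ (M + K) * rho ^+ (h + M) :> R.
  by rewrite !exprVn !exprD invfM; field; rewrite !expf_neq0.
rewrite ler_pM2l ?exprn_gt0 ?invr_gt0//.
by apply: ler_wiXn2l => //; exact: ltW.
Qed.

(** The first entry 1, at index [index 1%N k], yields the step of the chains
    since [k_(i+a) <= k_i + k_a = k_i + 1]; the positive entries before it are at
    least 2.  If 1 does not occur, the step exceeds the size of the list and
    there are no links. *)
Lemma window_segment (D : nat) (k : seq nat) (o n : nat) :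
  (o + n <= size k)%N -> (forall i, (i < size k)%N -> (0 < nth 0 k i)%N) ->
  subadditive_seq k ->
  (forall i, (i < n)%N -> (nth 0 k (o + i) <= D)%N) ->
  (forall i, (i < n)%N -> (D <= nth 0 k (o + i) + nth 0 k (o + (n.-1 - i)))%N) ->
  segment D (index 1%N k).+1 (index 1%N k - o) n (take n (drop o k)).
Proof.
move=> onk k0 ksub kD kmir.
have E i : (i < n)%N -> nth 0%N (take n (drop o k)) i = nth 0%N k (o + i).
  by move=> iltn; rewrite nth_take// nth_drop.
have tn : size (take n (drop o k)) = n by rewrite size_takel// size_drop; lia.
split=> // [i iltn|i iltn|i iltn ib|i iltn].
- by rewrite E// kD// k0; lia.
- by rewrite !E ?kmir//; lia.
- have H : (o + i < index 1%N k)%N by lia.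
  have := before_find 0%N H; have := k0 (o + i)%N.
  by rewrite E//=; case: (nth 0%N k (o + i)) => [|[|]]//; lia.
- rewrite !E//; last by lia.
  have kl : (index 1 k < size k)%N by lia.
  have k1 : nth 0%N k (index 1%N k) = 1%N by rewrite nth_index// -index_mem.
  rewrite (_ : o + (i + (index 1 k).+1) = (o + i) + index 1 k + 1)%N; last by lia.
  by rewrite -[(_ (o + i)).+1]addn1 -{3}k1; apply: ksub; lia.
Qed.

(** A generous constant for all boundary effects. *)
Definition loss : nat := 400.

(** Without its last entry 3, a stressed list is a single segment, in which
    at most one chain starts at a pair without any of the entries before the
    first 1. *)
Lemma stressed_bounded (R : realType) :
  exists B, sum_bounded (fun k => (X0 : R) ^+ sumn k) stressed B.
Proof.
have X01 := X0_itv R; have /andP[X00 X1] := X01; have /andP[r0 r1] := rho_itv R.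
have C0 : 0 <= (1 - X0)^-1 * rho^-1 ^+ loss :> R.
  apply: mulr_ge0; first by rewrite invr_ge0 subr_ge0 ltW.
  by apply: exprn_ge0; rewrite invr_ge0 ltW.
apply: (size_graded_bounded C0) => n.
pose c := (1 - X0)^-1 * (rho^-1 ^+ loss * rho ^+ n./2) : R.
have c0 : 0 <= c by rewrite /c mulrA; apply: mulr_ge0 => //; apply: exprn_ge0; exact: ltW.
apply: (@sum_boundedW _ _ _ _ _ (\sum_(a < n.+1) c) _ (@subset_refl _ _)).
  rewrite sumr_const card_ord -[leLHS]mulr_natl /c.
  rewrite [leRHS](_ : _ = (n.+1 ^ 2)%:R * c); last by rewrite /c; ring.
  by rewrite ler_wpM2r// ler_nat -mulnn leq_pmulr.
apply: (sum_bounded_cover (B := fun a => [set k | index 1%N k = a])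
  (c := fun _ => c)).
- by move=> k; exact: exprn_ge0.
- by move=> k [_ kn]; exists (index 1%N k) => //; rewrite ltnS -kn; exact: index_size.
move=> a an.
have SB := @segment_bounded R 3 a.+1 a n.-1 (Or31 _ _ erefl) isT (leqnSn a).
apply: (@sum_bounded_inj _ _ _ _ (fun t => X0 ^+ sumn t) _
  (segment 3 a.+1 a n.-1) (take n.-1)).
- move=> k [[[k0 k3 ksub klast] /= kn] ka]; split.
    have := @window_segment 3 k 0 n.-1; rewrite subn0 drop0 ka.
    apply=> // [|i /k3/andP[]//|i ik|i ik].
    + by rewrite kn leq_pred.
    + by have /k3/andP[] : (i < size k)%N by rewrite kn; clear -ik; lia.
    + rewrite !add0n -klast (_ : (size k).-1 = i + (n.-1.-1 - i) + 1)%N.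
        by apply: ksub; rewrite kn; clear -ik; lia.
      by rewrite kn; clear -ik; lia.
  rewrite -[leLHS](_ : X0 ^+ sumn (take n.-1 k ++ drop n.-1 k) = _).
    rewrite sumn_cat exprD; apply: ler_piMr; first exact: exprn_ge0.
    by apply: exprn_ile1 => //; exact: ltW.
  by rewrite cat_take_drop.
- move=> s t [[[s0 _ _ sl] /= sn] _] [[[t0 _ _ tl] /= tn] _] st.
  rewrite -(cat_take_drop n.-1 s) -(cat_take_drop n.-1 t) st.
  have n0 : (n.-1 < n)%N by rewrite -sn prednK.
  congr (_ ++ _); rewrite (drop_nth 0%N) ?sn// [RHS](drop_nth 0%N) ?tn//.
  by rewrite !drop_oversize ?prednK ?sn ?tn ?(leq_ltn_trans _ n0)// -{1}sn sl -tn tl.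
apply: sum_boundedW SB => //.
apply: ler_wpM2l; first by rewrite invr_ge0 subr_ge0 ltW.
by apply: rho_exchange; rewrite /loss; clear -an; lia.
Qed.

Lemma last_large (q : nat) (k : seq nat) : has (leq q) k ->
  exists l, [/\ (l < size k)%N, (q <= nth 0 k l)%N
    & forall i, (l < i)%N -> (i < size k)%N -> (nth 0 k i < q)%N].
Proof.
move=> hk; pose P i := ((i < size k) && (q <= nth 0 k i))%N.
have exP : exists i, P i.
  by exists (find (leq q) k); rewrite /P -has_find hk; exact: nth_find.
have Pm i : P i -> (i <= size k)%N by case/andP => /ltnW.
have [l /andP[lk ql] lmax] := ex_maxnP exP Pm.
exists l; split => // i li ik; rewrite ltnNge; apply/negP => qi.
have Pi : P i by rewrite /P ik qi.
by have := lmax i Pi; rewrite leqNgt li.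
Qed.

(** Before the position [l], mirrored residues add up to the residue of [l].
    After it they do so modulo the multiplicity, at the cost of the carry 1. *)
Lemma kunz_mirror (q l : nat) (k : seq nat) : kunz k -> (l < size k)%N ->
  (q.+1 <= nth 0 k l)%N ->
  (forall i, (i < l)%N -> (q.+1 <= nth 0 k i + nth 0 k (l.-1 - i))%N) /\
  (forall i, (i < size k - l.+1)%N ->
    (q <= nth 0 k (l.+1 + i) + nth 0 k (l.+1 + ((size k - l.+1).-1 - i)))%N).
Proof.
move=> [_ ksub kwrap] lk ql; split=> i il.
  apply: (leq_trans ql); rewrite {1}(_ : l = i + (l.-1 - i) + 1)%N; last by lia.
  by apply: ksub; lia.
rewrite -ltnS; apply: (leq_trans ql).
set j := (l.+1 + _)%N; set j' := (l.+1 + (_ - i))%N.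
rewrite {1}(_ : l = j + j' - size k)%N; last by rewrite /j /j'; lia.
by apply: kwrap; rewrite /j /j'; lia.
Qed.

Definition depth_at (q n l : nat) : set (seq nat) :=
  [set k | [/\ kunz k, size k = n, (q <= nth 0 k l)%N &
     forall i, (l < i)%N -> (i < n)%N -> (nth 0 k i < q)%N]].

(** If [a] entries precede the first 1, at most about [a] chains of the two
    segments start at a pair without any of these entries.  Hence, up to a
    constant, the gains [35 * a] exceed the losses [30 * a] by enough to make up
    also for the at most [4 * a] starts and ends of chains, where nothing is
    contracted. *)
Lemma moderate_bounded (R : realType) (q n l a : nat) :
  q = 3%N \/ q = 4%N -> (l < n)%N -> (a <= n)%N ->
  sum_bounded (fun k => (X0 : R) ^+ sumn k)
    [set k | [/\ depth_at q.+1 n l k, index 1%N k = a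
       & forall i, (i < n)%N -> (nth 0 k i <= q.+1)%N]]
    ((1 - X0)^-1 ^+ 3 * (rho^-1 ^+ loss * rho ^+ n./2)).
Proof.
move=> qE ln an.
have X01 := X0_itv R; have /andP[X00 X1] := X01; have /andP[r0 r1] := rho_itv R.
have q1 : [\/ q = 3, q = 4 | q = 5]%N by case: qE => ->; [apply: Or31|apply: Or32].
have q2 : [\/ q.+1 = 3, q.+1 = 4 | q.+1 = 5]%N.
  by case: qE => ->; [apply: Or32|apply: Or33].
have SA := @segment_bounded R q.+1 a.+1 a l q2 isT (leqnSn a).
have ba : (a - l.+1 <= a.+1)%N by exact: leq_trans (leq_subr _ _) (leqnSn _).
have SB := @segment_bounded R q a.+1 (a - l.+1) (n - l.+1) q1 isT ba.
move: SA SB; set c := ((1 - X0)^-1 * _); set d := ((1 - X0)^-1 * _) => SA SB.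
have i0 : 0 <= (1 - X0)^-1 :> R by rewrite invr_ge0 subr_ge0 ltW.
have ri0 : 0 <= rho^-1 :> R by rewrite invr_ge0 ltW.
have c0 : 0 <= c.
  by rewrite mulr_ge0// mulr_ge0//; apply: exprn_ge0 => //; exact: ltW.
have d0 : 0 <= d.
  by rewrite mulr_ge0// mulr_ge0//; apply: exprn_ge0 => //; exact: ltW.
apply: (sum_boundedW _ _ (split_bounded ln c0 d0 SA SB)).
  move=> k [[kK /= kn kl klater] ka kq]; have [k0 ksub kwrap] := kK.
  have lk : (l < size k)%N by rewrite kn.
  have [mir1 mir2] := kunz_mirror kK lk kl.
  split => //.
    have := @window_segment q.+1 k 0 l; rewrite subn0 drop0 ka; apply=> //.
      by rewrite kn ltnW.
    by move=> i il; apply: kq; rewrite add0n (ltn_trans il).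
  have := @window_segment q k l.+1 (n - l.+1).
  rewrite ka take_oversize ?size_drop ?kn//; apply=> //.
  - by rewrite subnKC.
  - by move=> i il; apply: k0; rewrite kn.
  - by move=> i il; rewrite -ltnS; apply: klater; clear -il; lia.
  - by rewrite -kn.
rewrite /c /d.
set E1 := (35 * (minn a l).-1 + _)%N; set M1 := (30 * (a.+1 - a))%N.
set E2 := (35 * _ + _)%N; set M2 := (30 * _)%N.
have H := @rho_exchange R (E1 + E2) (M1 + M2) loss n./2.
rewrite [leLHS](_ : _ = (1 - X0)^-1 ^+ 3 *
   (rho ^+ (E1 + E2) * rho^-1 ^+ (M1 + M2))); last by rewrite !exprD; ring.
rewrite ler_wpM2l ?exprn_ge0//; apply: H.
by rewrite /E1 /E2 /M1 /M2 /loss; clear -ln an; lia.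
Qed.

(** With an entry at least 6 at [l], all mirrored sums are at least 6 before [l]
    and at least 5 after it, where moreover the entries are at most 5. *)
Lemma large_bounded (R : realType) (n l : nat) : (l < n)%N ->
  sum_bounded (fun k => (X0 : R) ^+ sumn k) (depth_at 6 n l)
    ((1 - X0)^-1 ^+ 3 * (rho^-1 ^+ loss * rho ^+ n./2)).
Proof.
move=> ln.
have X01 := X0_itv R; have /andP[X00 X1] := X01; have /andP[r0 r1] := rho_itv R.
have SA := @naive_segment_bounded R _ l (large_pairs_bounded R).
have SB := @naive_segment_bounded R _ (n - l.+1) (cells5_bounded R).
move: SA SB; set c := ((1 - X0)^-1 * _); set d := ((1 - X0)^-1 * _) => SA SB.
have i0 : 0 <= (1 - X0)^-1 :> R by rewrite invr_ge0 subr_ge0 ltW.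
have c0 : 0 <= c by rewrite mulr_ge0//; apply: exprn_ge0 => //; exact: ltW.
have d0 : 0 <= d by rewrite mulr_ge0//; apply: exprn_ge0 => //; exact: ltW.
apply: (sum_boundedW _ _ (split_bounded ln c0 d0 SA SB)).
  move=> k [kK /= kn kl klater]; have [k0 ksub kwrap] := kK.
  have lk : (l < size k)%N by rewrite kn.
  have [mir1 mir2] := kunz_mirror kK lk kl.
  split => //; split; first by rewrite size_takel// kn ltnW.
  - move=> i il; have il' : (l.-1 - i < l)%N by clear -il; lia.
    rewrite !nth_take//; split=> /=; last exact: mir1.
      by apply: k0; rewrite kn (ltn_trans il).
    by apply: k0; rewrite kn (ltn_trans il').
  - by rewrite size_drop kn.
  - move=> i il; have il' : ((n - l.+1).-1 - i < n - l.+1)%N by clear -il; lia.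
    rewrite !nth_drop /= mem_cells /=.
    have B j : (j < n - l.+1)%N -> (1 <= nth 0 k (l.+1 + j) <= 5)%N.
      move=> jl; have jn : (l.+1 + j < n)%N by clear -jl; lia.
      by rewrite k0 ?kn//= -ltnS; apply: klater; rewrite // leq_addr.
    rewrite !B//=; have := mir2 i; rewrite kn; exact.
rewrite /c /d.
have H := @rho_exchange R (l./2 + (n - l.+1)./2) 0 loss n./2.
rewrite [leLHS](_ : _ = (1 - X0)^-1 ^+ 3 *
   (rho ^+ (l./2 + (n - l.+1)./2) * rho^-1 ^+ 0)); last by rewrite !exprD; ring.
rewrite ler_wpM2l ?exprn_ge0//; apply: H.
by rewrite /loss; clear -ln; lia.
Qed.

Lemma deep_bounded (R : realType) :
  exists B, sum_bounded (fun k => (X0 : R) ^+ sumn k)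
    [set k | kunz k /\ has (leq 4) k] B.
Proof.
have X01 := X0_itv R; have /andP[X00 X1] := X01; have /andP[r0 r1] := rho_itv R.
have i0 : 0 <= (1 - X0)^-1 :> R by rewrite invr_ge0 subr_ge0 ltW.
have C0 : 0 <= 3 * ((1 - X0)^-1 ^+ 3 * rho^-1 ^+ loss) :> R.
  rewrite mulr_ge0// mulr_ge0//; apply: exprn_ge0 => //.
  by rewrite invr_ge0 ltW.
apply: (size_graded_bounded C0) => n.
pose c := (1 - X0)^-1 ^+ 3 * (rho^-1 ^+ loss * rho ^+ n./2) : R.
have c0 : 0 <= c.
  rewrite /c mulr_ge0 ?exprn_ge0// mulr_ge0//; apply: exprn_ge0; rewrite ?ltW//.
  by rewrite invr_gt0.
have w0 (k : seq nat) : 0 <= (X0 : R) ^+ sumn k by exact: exprn_ge0.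
(* [q = 0, 1, 2] stands for the largest entry being 4, 5, or at least 6. *)
pose B q := [set k | if q is q'.+2 then has (leq 6) k else
  has (leq (4 + q)%N) k /\ forall i, (i < n)%N -> (nth 0 k i <= 4 + q)%N].
apply: (@sum_boundedW _ _ _ _ _
  (\sum_(q < 3) \sum_(l < n) \sum_(a < n.+1) c) _ (@subset_refl _ _)).
  rewrite !sumr_const !card_ord -!mulrnA -[leLHS]mulr_natr.
  rewrite [leRHS](_ : _ = c * (3 * n.+1 ^ 2)%:R); last first.
    by rewrite natrM /c; ring.
  by rewrite ler_wpM2l// ler_nat -mulnn; nia.
apply: (sum_bounded_cover (B := B) (c := fun _ => \sum_(l < n) \sum_(a < n.+1) c)) => //.
  move=> k [[kK k4] /= kn].
  have [k6|k6] := boolP (has (leq 6) k); first by exists 2%N.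
  have k6' i : (i < n)%N -> (nth 0 k i <= 5)%N.
    move=> ik; move/hasPn : k6 => /(_ (nth 0 k i)%N); rewrite -ltnNge ltnS; apply.
    by apply: mem_nth; rewrite kn.
  have [k5|k5] := boolP (has (leq 5) k); first by exists 1%N.
  exists 0%N => //; split => // i ik; move/hasPn : k5 => /(_ (nth 0 k i)%N).
  by rewrite -ltnNge ltnS; apply; apply: mem_nth; rewrite kn.
move=> q q3.
pose D q := if q is q'.+2 then 6%N else (4 + q)%N.
apply: (sum_bounded_cover (B := fun l => depth_at (D q) n l)
  (c := fun _ => \sum_(a < n.+1) c)) => //.
  move=> k [[[kK k4] /= kn] Bk].
  have : has (leq (D q)) k by move: Bk; case: q q3 => [|[|]]//= _ [].
  by move=> /last_large[l [lk ql lmax]]; exists l; rewrite -kn.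
move=> l ln.
apply: (sum_bounded_cover (B := fun a => [set k | index 1%N k = a])
  (c := fun _ => c)) => //.
  by move=> k [[[_ /= kn] _] _]; exists (index 1%N k); rewrite // ltnS -kn index_size.
move=> a an.
case: q q3 => [|[|q]] q3.
- apply: (sum_boundedW _ (lexx _) (moderate_bounded R (or_introl erefl) ln an)).
  by move=> k [[[_ [_ kq]] Dk] ka]; split.
- apply: (sum_boundedW _ (lexx _) (moderate_bounded R (or_intror erefl) ln an)).
  by move=> k [[[_ [_ kq]] Dk] ka]; split.
- apply: (sum_boundedW _ (lexx _) (large_bounded R ln)).
  by move=> k [[_ Dk] _].
Qed.

(** * Semigroups and Kunz lists *)

Local Open Scope nat_scope.

(** The list [0 :: k] gives the thresholds of all residues modulo the
    multiplicity [(size k).+1], the residue 0 included. *)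
Definition semigroup_of (k : seq nat) : set nat :=
  [set n | nth 0 (0 :: k) (n %% (size k).+1) <= n %/ (size k).+1].

Lemma semigroup_ofE (k : seq nat) (r j : nat) : r <= size k ->
  semigroup_of k (r + j * (size k).+1) <-> nth 0 (0 :: k) r <= j.
Proof.
move=> rk; rewrite /semigroup_of /= addnC.
by rewrite modnMDl modn_small// divnMDl// divn_small// addn0.
Qed.

Definition gaps_of (k : seq nat) : seq nat :=
  [seq r + j * (size k).+1 | r <- iota 0 (size k).+1,
                             j <- iota 0 (nth 0 (0 :: k) r)].

Lemma semigroup_of_gaps (k : seq nat) :
  fset_set (~` semigroup_of k) = [fset x in gaps_of k]%fset
  /\ finite_set (~` semigroup_of k).
Proof.
set G := [fset x in _]%fset.
have E : ~` semigroup_of k = [set` G].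
  apply/seteqP; split=> n /=; rewrite in_fset.
    rewrite /semigroup_of /= => /negP; rewrite -ltnNge => nlt.
    apply/allpairsPdep; exists (n %% (size k).+1), (n %/ (size k).+1).
    by rewrite !mem_iota !add0n ltn_mod nlt; split => //; rewrite addnC -divn_eq.
  move=> /allpairsPdep[r [j]]; rewrite !mem_iota !add0n ltnS /= => -[rk jr ->].
  by rewrite -/(semigroup_of k _) semigroup_ofE// leqNgt jr.
by split; rewrite E; [rewrite set_fsetK|exact: finite_fset].
Qed.

Lemma genus_semigroup_of (k : seq nat) : genus (semigroup_of k) = sumn k.
Proof.
rewrite /genus (semigroup_of_gaps k).1 card_fseq undup_id.
  rewrite size_allpairs_dep.
  under eq_map do rewrite size_iota.
  rewrite -[X in sumn X]/(mkseq (nth 0 (0 :: k)) (size (0 :: k))).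
  by rewrite mkseq_nth.
apply: allpairs_uniq_dep; rewrite ?iota_uniq//.
  by move=> r _; exact: iota_uniq.
move=> [r j] [r' j'] /allpairsPdep[r1 [j1]].
rewrite mem_iota => -[/andP[_ rk] _ [-> /= ->]].
move=> /allpairsPdep[r2 [j2]]; rewrite mem_iota => -[/andP[_ rk'] _ [-> /= ->]].
move=> H; have Hr : r1 = r2.
  have := congr1 (modn^~ (size k).+1) H.
  by rewrite /= addnC [in RHS]addnC !modnMDl !modn_small.
move: H; rewrite Hr => /addnI/eqP; rewrite eqn_pmul2r// => /eqP ->//.
Qed.

Lemma semigroup_ofP (k : seq nat) : kunz k -> numerical_semigroup (semigroup_of k).
Proof.
move=> [k0 ksub kwrap]; split; last exact: (semigroup_of_gaps k).2.
  by rewrite /semigroup_of /mkset mod0n.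
move=> x y; rewrite (divn_eq x (size k).+1) (divn_eq y (size k).+1).
set p := x %/ _; set q := y %/ _; set i := x %% _; set j := y %% _.
have ik : i <= size k by rewrite -ltnS ltn_mod.
have jk : j <= size k by rewrite -ltnS ltn_mod.
rewrite ![_ * _ + _]addnC !semigroup_ofE// => ip jq.
have -> : i + p * (size k).+1 + (j + q * (size k).+1) = i + j + (p + q) * (size k).+1.
  by rewrite mulnDl; lia.
have [ij|ij] := leqP (i + j) (size k).
  rewrite semigroup_ofE//; case: i ik ip ij => [|i] ik ip ij.
    by rewrite add0n (leq_trans jq)// leq_addl.
  case: j jk jq ij => [|j] jk jq ij.
    by rewrite addn0 (leq_trans ip)// leq_addr.
  rewrite /= in ip jq; rewrite (_ : i.+1 + j.+1 = (i + j + 1).+1) /=; last by lia.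
  by apply: leq_trans (ksub i j _) _; [|exact: leq_add]; lia.
have -> : i + j + (p + q) * (size k).+1 = (i + j - (size k).+1) + (p + q).+1 * (size k).+1.
  by rewrite mulSn; lia.
rewrite semigroup_ofE; last by lia.
case: i ik ip ij => [|i] ik ip ij; first by lia.
case: j jk jq ij => [|j] jk jq ij; first by lia.
case E : (i.+1 + j.+1 - (size k).+1) => [//|r] /=.
have -> : r = i + j - size k by lia.
by rewrite /= in ip jq; apply: leq_trans (kwrap i j _ _ _) _; rewrite ?ltnS ?leq_add//; lia.
Qed.

Lemma semigroup_of_multiplicity (k : seq nat) : kunz k ->
  semigroup_of k (size k).+1 /\
  forall n, 0 < n -> n <= size k -> ~ semigroup_of k n.
Proof.
move=> [k0 _ _]; split; first by rewrite /semigroup_of /mkset modnn.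
move=> [//|n] _ nk; rewrite /semigroup_of /mkset modn_small// divn_small//=.
by have := k0 n nk; case: nth.
Qed.

(** The semigroup determines its multiplicity, hence the size of the list, and
    then each entry as a threshold. *)
Lemma semigroup_of_inj (k k' : seq nat) : kunz k -> kunz k' ->
  semigroup_of k = semigroup_of k' -> k = k'.
Proof.
move=> kK kK' E; have [m1 m2] := semigroup_of_multiplicity kK.
have [m1' m2'] := semigroup_of_multiplicity kK'.
have kk' : size k = size k'.
  apply/eqP; rewrite eqn_leq; apply/andP; split; rewrite leqNgt; apply/negP => H.
    by apply: (m2 (size k').+1) => //; rewrite E.
  by apply: (m2' (size k).+1) => //; rewrite -E.
apply: (@eq_from_nth _ 0) => // i ik.
have H j : (nth 0 k i <= j) = (nth 0 k' i <= j).
  have := @semigroup_ofE k' i.+1 j; rewrite -kk' -E => /(_ ik) /= H'.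
  have /= H := @semigroup_ofE k i.+1 j ik.
  by apply/idP/idP => [/H/H'|/H'/H].
apply/eqP; rewrite eqn_leq H leqnn /=.
by rewrite -H leqnn.
Qed.

Lemma multiplicity_exists (S : set nat) : numerical_semigroup S ->
  exists m, S m.+1 /\ forall n, 0 < n -> n <= m -> ~ S n.
Proof.
move=> nS; pose P n := `[< S n.+1 >].
have exP : exists n, P n.
  exists (genus S).*2; apply/asboolP; apply: contrapT => /(gap_lt nS).
  by rewrite ltnNge leqnSn.
have [m /asboolP Sm mmin] := ex_minnP exP.
exists m; split => // -[//|n] _ nm Sn.
have Pn : P n by apply/asboolP.
by have := mmin n Pn; rewrite leqNgt nm.
Qed.

(** The entries are the thresholds of the residues modulo the least positive
    element, and the inequalities express the closure under addition. *)
Lemma semigroup_of_surj (S : set nat) : numerical_semigroup S ->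
  exists2 k, kunz k & semigroup_of k = S.
Proof.
move=> nS; have [m [Sm mmin]] := multiplicity_exists nS.
have [S0 SD fS] := nS.
have SM j : S (j * m.+1).
  by elim: j => [|j IH]; rewrite ?mul0n// mulSn; exact: SD.
have exE r : exists j, `[< S (r + j * m.+1) >].
  exists (genus S).*2; apply/asboolP; apply: contrapT => /(gap_lt nS).
  by rewrite ltnNge => /negP; apply; rewrite (leq_trans _ (leq_addl _ _))// leq_pmulr.
pose e r := ex_minn (exE r).
have eP r j : (e r <= j) <-> S (r + j * m.+1).
  rewrite /e; case: ex_minnP => n /asboolP Sn nmin; split=> [nj|/asboolP/nmin//].
  by rewrite -(subnK nj) mulnDl addnCA addnC; apply: SD.
have e0 : e 0 = 0 by apply/eqP; rewrite -leqn0; apply/eP.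
pose k := mkseq (fun i => e i.+1) m.
have km : size k = m by rewrite size_mkseq.
have kE r : r <= m -> nth 0 (0 :: k) r = e r.
  by case: r => [|r] rm; rewrite ?e0//= nth_mkseq.
have kS : semigroup_of k = S.
  apply/seteqP; split=> n; rewrite /semigroup_of /mkset km kE ?eP.
  - by rewrite addnC -divn_eq.
  - by rewrite -ltnS ltn_mod.
  - by rewrite addnC -divn_eq.
  - by rewrite -ltnS ltn_mod.
exists k => //.
have kEi i : i < m -> nth 0 k i = e i.+1 by move=> im; rewrite nth_mkseq.
split=> [i|i j|i j]; rewrite km.
- move=> im; rewrite kEi// ltnNge; apply/negP => /eP; rewrite mul0n addn0.
  exact: mmin.
- move=> ijm; rewrite !kEi//; try by lia.
  apply/eP.
  have := SD _ _ ((eP i.+1 _).1 (leqnn _)) ((eP j.+1 _).1 (leqnn _)).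
  by congr S; rewrite mulnDl; lia.
- move=> im jm mij; rewrite !kEi//; try by lia.
  apply/eP.
  have := SD _ _ ((eP i.+1 _).1 (leqnn _)) ((eP j.+1 _).1 (leqnn _)).
  by congr S; rewrite mulSn mulnDl; lia.
Qed.

Definition kunz_lists (g : nat) : set (seq nat) := [set k | kunz k /\ sumn k = g].

Lemma semigroups_of_kunz (g : nat) :
  semigroups_of g = semigroup_of @` kunz_lists g.
Proof.
apply/seteqP; split=> [S [nS gS]|_ [k [kK kg] <-]].
  have [k kK kS] := semigroup_of_surj nS.
  by exists k => //; split => //; rewrite -genus_semigroup_of kS.
by split; [exact: semigroup_ofP|rewrite genus_semigroup_of].
Qed.

Lemma kunz_lists_inj (g : nat) : {in kunz_lists g &, injective semigroup_of}.
Proof.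
by move=> k k'; rewrite !in_setE => -[kK _] [kK' _]; exact: semigroup_of_inj.
Qed.

Lemma kunz_lists_finite (g : nat) : finite_set (kunz_lists g).
Proof.
have := semigroups_of_finite g; rewrite semigroups_of_kunz.
by rewrite (eq_finite_set (inj_card_eq (@kunz_lists_inj g))).
Qed.

Lemma nsg_kunz (g : nat) : nsg g = #|` fset_set (kunz_lists g)|.
Proof.
rewrite /nsg semigroups_of_kunz fset_set_image; last exact: kunz_lists_finite.
apply: card_in_imfset => k k' /=.
rewrite !in_fset_set; try exact: kunz_lists_finite.
exact: kunz_lists_inj.
Qed.

(** * Counting Kunz lists *)

Definition setcard {T : choiceType} (A : set T) : nat := #|` fset_set A|.

Lemma setcard_setU (T : choiceType) (A B : set T) : finite_set A -> finite_set B ->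
  (forall t, A t -> ~ B t) -> setcard (A `|` B) = setcard A + setcard B.
Proof.
move=> fA fB AB; rewrite /setcard fset_setU// cardfsU.
rewrite (_ : (_ `&` _)%fset = fset0) ?cardfs0 ?subn0//.
apply/fsetP => t; rewrite in_fsetI !in_fset_set// in_fset0.
by apply/negP => /andP[]; rewrite !in_setE; exact: AB.
Qed.

Lemma setcard_image (T U : choiceType) (f : T -> U) (A : set T) : finite_set A ->
  injective f -> setcard (f @` A) = setcard A.
Proof.
move=> fA fI; rewrite /setcard fset_set_image//; apply: card_imfset; exact: fI.
Qed.

Definition shallow (g : nat) : set (seq nat) :=
  [set k | [/\ forall i, i < size k -> 0 < nth 0 k i <= 3, subadditive_seq k
             & sumn k = g]].

Definition stressed_of (g : nat) : set (seq nat) :=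
  [set k | stressed k /\ sumn k = g].

Definition deep (g : nat) : set (seq nat) :=
  [set k | (kunz k /\ has (leq 4) k) /\ sumn k = g].

(** For entries between 1 and 3 the wrap-around condition holds automatically,
    because [3 <= 1 + 1 + 1]. *)
Lemma kunz_lists_split (g : nat) : kunz_lists g = shallow g `|` deep g.
Proof.
apply/seteqP; split=> [k [kK kg]|k [[k3 ksub kg]|[[kK _] kg]]] //.
  have [k4|k4] := boolP (has (leq 4) k); [by right|left].
  have [k0 ksub _] := kK; split => // i ik; rewrite k0//=.
  by move/hasPn : k4 => /(_ _ (mem_nth 0 ik)); rewrite -ltnNge ltnS.
split => //; split => // [i /k3/andP[]//|i j ik jk ij].
have /k3/andP[_ H] : i + j - size k < size k by lia.
by apply: (leq_trans H); have /andP[+ _] := k3 i ik; have /andP[+ _] := k3 j jk; lia.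
Qed.

Lemma shallow_finite (g : nat) : finite_set (shallow g).
Proof.
apply: sub_finite_set (kunz_lists_finite g).
by rewrite kunz_lists_split; exact: subsetUl.
Qed.

Lemma deep_finite (g : nat) : finite_set (deep g).
Proof.
apply: sub_finite_set (kunz_lists_finite g).
by rewrite kunz_lists_split; exact: subsetUr.
Qed.

Lemma stressed_of_finite (g : nat) : finite_set (stressed_of g).
Proof.
by apply: sub_finite_set (shallow_finite g) => k [[_ k3 ksub _] kg]; split.
Qed.

Lemma nsg_split (g : nat) : nsg g = setcard (shallow g) + setcard (deep g).
Proof.
rewrite nsg_kunz kunz_lists_split; apply: setcard_setU.
- exact: shallow_finite.
- exact: deep_finite.
move=> k [k3 _ _] [[_ /hasP[v /(nthP 0)[i ik <-] v4]] _].
by have /andP[_ H] := k3 i ik; have := leq_trans v4 H.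
Qed.

(** A new last entry at most 2 is under no constraint, because any two entries
    add up to at least 2. *)
Lemma shallow_rcons (c g : nat) (s : seq nat) : 0 < c <= 2 ->
  shallow (g + c) (rcons s c) <-> shallow g s.
Proof.
move=> /andP[c0 c2]; rewrite /shallow /= size_rcons sumn_rcons.
split=> [[s3 ssub /addIn sg]|[s3 ssub ->]].
  split => // [i ik|i j ij].
    by have := s3 i (ltnW ik); rewrite nth_rcons ik.
  have si : i < size s by clear -ij; lia.
  have sj : j < size s by clear -ij; lia.
  by have := ssub i j; rewrite size_rcons !nth_rcons ij si sj; apply; exact: ltnW.
split => // [i ik|i j].
  rewrite nth_rcons; case: (ltnP i (size s)) => [si|si]; first exact: s3.
  have -> : i == size s by rewrite eqn_leq si andbT -ltnS.
  by rewrite c0 (leq_trans c2).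
rewrite size_rcons !nth_rcons => ij.
have si : i < size s by lia.
have sj : j < size s by lia.
rewrite si sj; case: ltnP => [/ssub//|sij].
rewrite (_ : (_ == _) = true); last by lia.
apply: (leq_trans c2).
by have /andP[+ _] := s3 i si; have /andP[+ _] := s3 j sj; lia.
Qed.

(** The three terms correspond to the last entries 1, 2 and 3. *)
Lemma shallow_recurrence (g : nat) :
  setcard (shallow g.+2) =
  setcard (shallow g.+1) + setcard (shallow g) + setcard (stressed_of g.+2).
Proof.
pose app c (s : seq nat) := rcons s c.
have appI c : injective (app c) by move=> s t /rcons_inj[].
have f1 : finite_set (app 1 @` shallow g.+1).
  by apply: finite_image; exact: shallow_finite.
have f2 : finite_set (app 2 @` shallow g).
  by apply: finite_image; exact: shallow_finite.
rewrite -(setcard_image (shallow_finite g.+1) (appI 1)).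
rewrite -(setcard_image (shallow_finite g) (appI 2)).
have -> : shallow g.+2 =
    ((app 1 @` shallow g.+1) `|` (app 2 @` shallow g)) `|` stressed_of g.+2.
  apply/seteqP; split=> k.
    case: (lastP k) => [[] //|s c Hk].
    have [k3 ksub kg] := Hk.
    have /k3 : size s < size (rcons s c) by rewrite size_rcons.
    rewrite nth_rcons ltnn eqxx => /andP[].
    case: c Hk k3 ksub kg => [//|[|[|[|//]]]] Hk k3 ksub kg _ _.
    - left; left; exists s => //.
      by apply/(@shallow_rcons 1) => //; rewrite addn1.
    - left; right; exists s => //.
      by apply/(@shallow_rcons 2) => //; rewrite addn2.
    - right; split => //; split=> //; first by rewrite size_rcons.
      by rewrite size_rcons nth_rcons ltnn eqxx.
  move=> [[[s Hs <-]|[s Hs <-]]|[[_ k3 ksub _] kg]] //.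
    by rewrite -addn1; apply/shallow_rcons.
  by rewrite -addn2; apply/shallow_rcons.
have f12 : finite_set ((app 1 @` shallow g.+1) `|` (app 2 @` shallow g)).
  by rewrite finite_setU.
rewrite (setcard_setU f12 (stressed_of_finite g.+2)); last first.
  by move=> k [[s _ <-]|[s _ <-]] [[_ _ _]]; rewrite size_rcons nth_rcons ltnn eqxx.
congr (_ + _)%N; rewrite (setcard_setU f1 f2)//.
by move=> _ [s _ <-] [t _ /rcons_inj[]].
Qed.

Lemma setcard_shallow0 : setcard (shallow 0) = 1.
Proof.
rewrite /setcard (_ : shallow 0 = [set [::]]) ?fset_set1 ?cardfs1//.
apply/seteqP; split=> [k [k3 _ k0]|_ ->]; last by split.
case: k k3 k0 => [//|v k] k3; have := k3 0 (ltn0Sn _).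
by case: v {k3}.
Qed.

Lemma setcard_shallow1 : setcard (shallow 1) = 1.
Proof.
rewrite -[RHS]setcard_shallow0 -(setcard_image (shallow_finite 0) (f := rcons^~ 1)); last first.
  by move=> s t /rcons_inj[].
congr setcard; apply/seteqP; split=> [k Hk|_ [s Hs <-]]; last first.
  exact: ((@shallow_rcons 1 0 s isT).2 Hs).
case: (lastP k) Hk => [[]//|s c Hk]; have [k3 _ ] := Hk.
have /k3 : size s < size (rcons s c) by rewrite size_rcons.
rewrite nth_rcons ltnn eqxx => /andP[c0 _]; rewrite sumn_rcons => sc.
have c1 : c = 1 by lia.
rewrite c1 in Hk *; exists s => //.
exact: ((@shallow_rcons 1 0 s isT).1 Hk).
Qed.

Local Open Scope ring_scope.

Lemma graded_bounded (R : realType) (X : R) (A : set (seq nat)) (B : R) :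
  (forall g, finite_set [set k | A k /\ sumn k = g]) ->
  sum_bounded (fun k => X ^+ sumn k) A B ->
  forall G, \sum_(0 <= g < G) (setcard [set k | A k /\ sumn k = g])%:R * X ^+ g <= B.
Proof.
move=> fA AB G; pose L g := enum_fset (fset_set [set k | A k /\ sumn k = g]).
have LP g k : k \in L g -> A k /\ sumn k = g.
  by rewrite /L -[_ \in _]/(k \in fset_set _) in_fset_set// in_setE.
have <- : \sum_(k <- [seq k | g <- index_iota 0 G, k <- L g]) X ^+ sumn k =
    \sum_(0 <= g < G) (setcard [set k | A k /\ sumn k = g])%:R * X ^+ g.
  rewrite big_allpairs_dep; apply: eq_bigr => g _.
  rewrite (_ : \sum_(k <- L g) X ^+ sumn k = \sum_(k <- L g) X ^+ g).
    by rewrite big_const_seq count_predT iter_addr_0 -[LHS]mulr_natl.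
  by rewrite big_seq [RHS]big_seq; apply: eq_bigr => k /LP[_ ->].
apply: AB => [|k /allpairsPdep[g [k' [_ /LP[Ak _] ->]]]//].
apply: allpairs_uniq_dep; first exact: iota_uniq.
  by move=> g _; exact: fset_uniq.
move=> [g k] [g' k'] /allpairsPdep[g1 [k1 [_ k1L [-> E1]]]].
move=> /allpairsPdep[g2 [k2 [_ k2L [-> E2]]]] /= kk'.
move: E1 E2 k1L k2L kk' => /= -> -> /LP[_ <-] /LP[_ <-] -> //.
Qed.

(** * Growth of the number of semigroups *)

Lemma contraction_cvg0 (R : realType) (r : R) (e d : R^nat) : 0 <= r < 1 ->
  (\forall n \near \oo, `|e n.+1| <= r * `|e n| + d n) ->
  d @ \oo --> 0 -> e @ \oo --> 0.
Proof.
move=> /andP[r0 r1] [N1 _ HN1] dto0; apply/cvgrPdist_le => eta eta0.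
have t0 : 0 < eta / 2 * (1 - r) by rewrite mulr_gt0 ?divr_gt0 ?subr_gt0.
move/cvgrPdist_le : dto0 => /(_ _ t0)[N2 _ HN2].
pose N := (N1 + N2)%N.
have step j : `|e (N + j)%N| <= r ^+ j * `|e N| + eta / 2.
  elim: j => [|j IH]; first by rewrite addn0 expr0 mul1r lerDl; lra.
  rewrite addnS; apply: (le_trans (HN1 (N + j)%N _)).
    by rewrite /= -addnA leq_addr.
  have : `|0 - d (N + j)%N| <= eta / 2 * (1 - r).
    by apply: HN2; rewrite /= /N addnAC leq_addl.
  rewrite sub0r normrN => /(le_trans (ler_norm _)) dj.
  have := ler_wpM2l r0 IH; rewrite exprS; lra.
have : (fun j => r ^+ j * `|e N|) @ \oo --> 0.
  rewrite -[0](mul0r `|e N|); apply: cvgM; last exact: cvg_cst.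
  by apply: cvg_expr; rewrite ger0_norm.
have eta2 : 0 < eta / 2 by lra.
move=> /cvgrPdist_le/(_ _ eta2)[J _ HJ].
exists (N + J)%N => // n /= NJn.
rewrite sub0r normrN -(@subnKC N n); last by apply: leq_trans NJn; exact: leq_addr.
have /HJ : (J <= n - N)%N by rewrite leq_subRL ?(leq_trans (leq_addr _ _) NJn).
rewrite sub0r normrN => /(le_trans (ler_norm _)) H.
by apply: (le_trans (step _)); lra.
Qed.

Lemma golden_gt1 (R : realType) : 1 < (golden : R).
Proof.
have : 1 < Num.sqrt (5 : R).
  by rewrite -[X in X < _]sqrtr1 ltr_sqrt; lra.
by rewrite /golden; lra.
Qed.

Lemma golden_sqr (R : realType) : (golden : R) ^+ 2 = golden + 1.
Proof.
have : Num.sqrt (5 : R) ^+ 2 = 5 by rewrite sqr_sqrtr.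
by rewrite /golden !expr2; lra.
Qed.

Lemma golden_inv (R : realType) : (golden : R)^-1 = golden - 1.
Proof.
have g1 := golden_gt1 R; have g2 := golden_sqr R.
have g0 : (golden : R) != 0 by rewrite gt_eqF//; lra.
by apply: (mulfI g0); rewrite mulfV// mulrBr -expr2 g2; lra.
Qed.

Lemma golden_inv_le (R : realType) : (golden : R)^-1 <= X0.
Proof.
have g1 := golden_gt1 R; have g2 := golden_sqr R; rewrite golden_inv /X0.
by rewrite leNgt; apply/negP => H; nra.
Qed.

Lemma bounded_series_cvg0 (R : realType) (u : R^nat) (B : R) :
  (forall n, 0 <= u n) -> (forall G, \sum_(0 <= g < G) u g <= B) ->
  u @ \oo --> 0.
Proof.
move=> u0 uB; apply: cvg_series_cvg_0.
apply: nondecreasing_is_cvgn.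
  by apply: nondecreasing_series => n _ _; exact: u0.
by exists B => _ [n _ <-]; exact: uB.
Qed.

(** Let [y] be the normalized counting sequence and [x] the inverse of the
    golden ratio.  Since [x + x ^+ 2 = 1], the recurrence says that
    [z g = y g.+1 + x ^+ 2 * y g] increases exactly by the summable
    contribution of the stressed lists, so that [z] converges to a limit at
    least [z 0 = 1].  Then [y g.+1 = z g - x ^+ 2 * y g] is a contraction with
    convergent inhomogeneity. *)
Lemma shallow_growth (R : realType) :
  exists2 C : R, 0 < C &
    (fun g => (setcard (shallow g))%:R * golden^-1 ^+ g : R) @ \oo --> C.
Proof.
have gi := golden_inv R; have g1 := golden_gt1 R; have g2 := golden_sqr R.
pose x : R := golden^-1; have x0 : 0 < x by rewrite /x invr_gt0; lra.
have x2 : x ^+ 2 = 1 - x.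
  by rewrite /x gi sqrrB1 g2; lra.
have x1 : x < 1 by rewrite /x invf_lt1; lra.
have xX : x <= X0 by exact: golden_inv_le.
pose y g := (setcard (shallow g))%:R * x ^+ g : R.
pose s g := (setcard (stressed_of g))%:R * x ^+ g : R.
have s0 g : 0 <= s g by apply: mulr_ge0 => //; apply: exprn_ge0; exact: ltW.
have [B HB] := stressed_bounded R.
have sB G : \sum_(0 <= g < G) s g <= B.
  apply: le_trans (graded_bounded stressed_of_finite HB G).
  apply: ler_sum => g _; rewrite ler_wpM2l//.
  by apply: lerXn2r => //; rewrite nnegrE ltW// (lt_le_trans x0).
pose z g := y g.+1 + x ^+ 2 * y g.
have zS g : z g.+1 = z g + s g.+2.
  rewrite /z /y /s shallow_recurrence !natrD.
  rewrite (exprS x g.+1) (exprS x g).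
  move: (x ^+ g) => xg; rewrite !expr2 in x2 *.
  by rewrite x2; ring: x2.
have z0 : z 0%N = 1.
  by rewrite /z /y setcard_shallow0 setcard_shallow1 expr0 expr1 x2; lra.
have zE g : z g = 1 + \sum_(2 <= i < g.+2) s i.
  elim: g => [|g IH]; first by rewrite big_geq// addr0.
  by rewrite zS IH [in RHS]big_nat_recr//= addrA.
have znd : nondecreasing_seq z.
  by apply/nondecreasing_seqP => g; rewrite zS lerDl.
have zcvg : cvgn z.
  apply: nondecreasing_is_cvgn => //; exists (1 + B) => _ [g _ <-].
  rewrite zE lerD2l; apply: le_trans (sB g.+2).
  rewrite [leRHS](@big_cat_nat _ _ _ 2)//= lerDr.
  by apply: sumr_ge0.
set Z := limn z in zcvg.
have zZ : z @ \oo --> Z by [].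
have Z1 : 1 <= Z by rewrite -z0; exact: nondecreasing_cvgn_le.
pose C := Z / (1 + x ^+ 2).
have x20 : 0 < 1 + x ^+ 2 by rewrite addr_gt0// exprn_gt0.
have CE : C + x ^+ 2 * C = Z.
  by rewrite /C -{1}[_ / _]mul1r -mulrDl mulrCA mulfV ?mulr1 ?gt_eqF.
exists C; first by rewrite divr_gt0//; lra.
have : (fun g => y g - C) @ \oo --> 0.
  apply: (@contraction_cvg0 _ (x ^+ 2) _ (fun g => `|z g - Z|)).
  - by rewrite x2; lra.
  - exists 0%N => // g _ /=.
    rewrite (_ : y g.+1 - C = (z g - Z) - x ^+ 2 * (y g - C)); last first.
      by rewrite /z -CE; ring.
    apply: (le_trans (ler_normB _ _)).
    by rewrite normrM (ger0_norm (exprn_ge0 2 (ltW x0))) addrC.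
  - have /cvg_norm : (fun g => z g - Z) @ \oo --> 0.
      by rewrite -[0](subrr Z); apply: cvgB => //; exact: cvg_cst.
    by rewrite normr0.
move=> H; have : (fun g => y g - C + C) @ \oo --> 0 + C.
  by apply: cvgD => //; exact: cvg_cst.
rewrite add0r.
by under eq_fun do rewrite subrK.
Qed.

Lemma deep_negligible (R : realType) :
  (fun g => (setcard (deep g))%:R * golden^-1 ^+ g : R) @ \oo --> 0.
Proof.
have g1 := golden_gt1 R; have x0 : 0 < (golden : R)^-1 by rewrite invr_gt0; lra.
have [B HB] := deep_bounded R.
apply: (bounded_series_cvg0 (B := B)) => [g|G].
  by apply: mulr_ge0 => //; apply: exprn_ge0; exact: ltW.
apply: le_trans (graded_bounded deep_finite HB G).
apply: ler_sum => g _; rewrite ler_wpM2l//.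
have xX := golden_inv_le R.
by apply: lerXn2r => //; rewrite nnegrE ltW// (lt_le_trans x0).
Qed.

(** Zhai's theorem. *)
Lemma nsg_growth (R : realType) :
  exists2 C : R, 0 < C & (fun g => (nsg g)%:R / golden ^+ g : R) @ \oo --> C.
Proof.
have [C C0 HC] := shallow_growth R; exists C => //.
rewrite -[C]addr0.
rewrite (_ : (fun g => _) = (fun g => (setcard (shallow g))%:R * golden^-1 ^+ g +
    (setcard (deep g))%:R * golden^-1 ^+ g)).
  by apply: cvgD => //; exact: deep_negligible.
by apply/funext => g; rewrite -mulrDl -natrD -nsg_split exprVn.
Qed.

(** The quotients [S n / f n] obey
    [S n.+1 / f n.+1 = 1 + (f n / f n.+1) * (S n / f n)], whose limiting fixed
    point is [(1 - phi ^- 2)^-1 = phi]. *)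
Lemma ratio_asymp_sum (R : realType) (f : R^nat) (phi : R) :
  1 < phi -> phi ^+ 2 = phi + 1 ->
  (fun n => f n.+1 / f n) @ \oo --> phi ^+ 2 ->
  (fun n => f n.+1 / \sum_(0 <= i < n.+1) f i) @ \oo --> phi.
Proof.
move=> p1 p2 fr; pose S n := \sum_(0 <= i < n.+1) f i.
have p20 : 0 < phi ^+ 2 by rewrite p2; lra.
have phi0 : phi != 0 by rewrite gt_eqF//; lra.
have fgt : \forall n \near \oo, 0 < f n.+1 / f n.
  exact: (cvgr_gt (phi ^+ 2) fr).
have q : (fun n => f n / f n.+1) @ \oo --> (phi ^+ 2)^-1.
  under eq_fun do rewrite -invf_div.
  by apply: cvgV => //; rewrite gt_eqF.
have q12 : \forall n \near \oo, f n / f n.+1 < 1 / 2.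
  apply: (cvgr_lt _ q); rewrite -[ltRHS]invf_div divr1 ltf_pV2 ?posrE//.
  by rewrite p2; lra.
pose e n := S n / f n - phi.
have e0 : e @ \oo --> 0.
  apply: (@contraction_cvg0 _ (1 / 2) _
    (fun n => `|1 + f n / f n.+1 * phi - phi|)); first by apply/andP; split; lra.
    near=> n.
    have fn : 0 < f n.+1 / f n by near: n.
    have qn : f n / f n.+1 < 1 / 2 by near: n.
    have qn0 : 0 <= f n / f n.+1 by rewrite -invf_div invr_ge0 ltW.
    have fn0 : f n != 0.
      by apply: contraTneq fn => ->; rewrite invr0 mulr0 ltxx.
    have fn1 : f n.+1 != 0 by apply: contraTneq fn => ->; rewrite mul0r ltxx.
    have -> : e n.+1 = f n / f n.+1 * e n + (1 + f n / f n.+1 * phi - phi).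
      rewrite /e /S big_nat_recr//=; field; exact/andP.
    apply: (le_trans (ler_normD _ _)); rewrite lerD2r normrM.
    by rewrite ler_wpM2r// ger0_norm// ltW.
  have : (fun n => 1 + f n / f n.+1 * phi - phi) @ \oo -->
      1 + (phi ^+ 2)^-1 * phi - phi.
    apply: cvgB; last exact: cvg_cst.
    apply: cvgD; first exact: cvg_cst.
    by apply: cvgM => //; exact: cvg_cst.
  have -> : 1 + (phi ^+ 2)^-1 * phi - phi = 0.
    have pV : phi^-1 = phi - 1.
      by apply: (mulfI phi0); rewrite mulfV// mulrBr -expr2 p2; lra.
    by rewrite expr2 invfM divfK// pV; lra.
  by move/cvg_norm; rewrite normr0.
have SF : (fun n => S n / f n) @ \oo --> phi.
  rewrite -[phi]add0r (_ : (fun n => _) = (fun n => e n + phi)); last first.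
    by apply/funext => n; rewrite /e subrK.
  by apply: cvgD => //; exact: cvg_cst.
have H : (fun n => f n.+1 / f n * (S n / f n)^-1) @ \oo --> phi ^+ 2 * phi^-1.
  by apply: cvgM => //; apply: cvgV.
have -> : phi = phi ^+ 2 * phi^-1 by rewrite expr2 mulfK.
apply: cvg_trans H; apply: near_eq_cvg; near=> n.
have fn : 0 < f n.+1 / f n by near: n.
have fn0 : f n != 0.
  by apply: contraTneq fn => ->; rewrite invr0 mulr0 ltxx.
by rewrite invf_div mulrA divfK.
Unshelve. all: by end_near.
Qed.

(** * The theorem *)

Theorem proposition5p1 (R : realType) :
  let f : R^nat := fun gamma => (fsg gamma)%:R in
  let n : R^nat := fun g => (nsg g)%:R in
  let phi : R := golden in
  let D := asymp f (fun gamma => phi ^+ (2 * gamma)%N) in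
  [/\ D <-> asymp f (fun gamma => n (2 * gamma)%N),
      D -> (fun gamma => f gamma.+1 / f gamma) @ \oo --> phi ^+ 2
    & (fun gamma => f gamma.+1 / f gamma) @ \oo --> phi ^+ 2 ->
      (fun gamma => f gamma.+1 / \sum_(0 <= i < gamma.+1) f i) @ \oo --> phi].
Proof.
move=> f n phi D.
have p1 : 1 < phi := golden_gt1 R; have p2 : phi ^+ 2 = phi + 1 := golden_sqr R.
have phi0 : phi != 0 by rewrite gt_eqF//; lra.
have pX k : phi ^+ k != 0 by rewrite expf_neq0.
have [C C0 nC] := nsg_growth R.
have n2C : (fun g => n (2 * g)%N / phi ^+ (2 * g)) @ \oo --> C.
  apply: (@cvg_comp _ _ _ (fun g => (2 * g)%N) (fun g => n g / phi ^+ g) _ \oo _ _ nC).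
  apply/cvgnyPge => A; exists A => // g /= Ag; lia.
split.
- split=> -[l l0 fl].
  + exists (l / C); first by rewrite divr_gt0.
    have H : (fun g => f g / phi ^+ (2 * g) * (n (2 * g)%N / phi ^+ (2 * g))^-1)
        @ \oo --> l * C^-1.
      by apply: cvgM => //; apply: cvgV => //; rewrite gt_eqF.
    rewrite (_ : (fun k => _) = (fun g => f g / phi ^+ (2 * g) *
        (n (2 * g)%N / phi ^+ (2 * g))^-1))//.
    by apply/funext => g; rewrite invf_div mulrA divfK.
  + exists (l * C); first by rewrite mulr_gt0.
    have H : (fun g => f g / n (2 * g)%N * (n (2 * g)%N / phi ^+ (2 * g)))
        @ \oo --> l * C by apply: cvgM.
    apply: cvg_trans H; apply: near_eq_cvg.
    have npos : \forall g \near \oo, 0 < n (2 * g)%N / phi ^+ (2 * g).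
      exact: (cvgr_gt C n2C).
    near=> g; have ng : 0 < n (2 * g)%N / phi ^+ (2 * g) by near: g.
    have n0 : n (2 * g)%N != 0 by apply: contraTneq ng => ->; rewrite mul0r ltxx.
    by rewrite mulrA divfK.
- move=> [l l0 fl].
  have fl1 : (fun g => f g.+1 / phi ^+ (2 * g.+1)) @ \oo --> l.
    by rewrite -(cvg_shiftS (fun g => f g / phi ^+ (2 * g))) in fl.
  have H : (fun g => f g.+1 / phi ^+ (2 * g.+1) * (f g / phi ^+ (2 * g))^-1 *
      phi ^+ 2) @ \oo --> l * l^-1 * phi ^+ 2.
    apply: cvgM; last exact: cvg_cst.
    by apply: cvgM => //; apply: cvgV => //; rewrite gt_eqF.
  rewrite mulfV ?mul1r ?gt_eqF// in H.
  rewrite (_ : (fun gamma => _) = (fun g => f g.+1 / phi ^+ (2 * g.+1) *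
      (f g / phi ^+ (2 * g))^-1 * phi ^+ 2))//.
  apply/funext => g; rewrite invf_div mulnS exprD.
  have := pX (2 * g)%N; have := pX 2; move: (phi ^+ 2) (phi ^+ (2 * g)) => a b a0 b0.
  rewrite invfM !mulrA; rewrite -!mulrA [a^-1 * _]mulrCA; congr (_ * _).
  by rewrite [RHS](_ : _ = (b^-1 * b) * (a^-1 * a) * (f g)^-1); [rewrite !mulVf ?mul1r|ring].
- exact: ratio_asymp_sum.
Unshelve. all: by end_near.
Qed.
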